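(* Let $0\le\alpha<1$ and let $f=h+\overline{g}\in\mathcal{P}^{0}_{\mathcal{H}}(\alpha)$ with $h(z)=z+\sum_{n=2}^\infty a_nz^n$, $g(z)=\sum_{n=2}^\infty b_nz^n$. Let $r_f$ be the unique root in $(0,1)$ of $$r+2(1-\alpha)\sum_{n=2}^{\infty}\frac{r^n}{n}=1+2(1-\alpha)\sum_{n=2}^{\infty}\frac{(-1)^{n-1}}{n}.$$ Then $$|z|+\sum_{n=2}^{\infty}(|a_n|+|b_n|)|z|^n\le d(f(0),\partial f(\mathbb{D}))\quad\text{for all } |z|\le r_f.$$ The radius $r_f$ is best possible: for $f_\alpha(z)=z+\sum_{n=2}^{\infty}\frac{2(1-\alpha)}{n}z^n\in\mathcal{P}^{0}_{\mathcal{H}}(\alpha)$, equality holds when $|z|=r_f$, and the inequality fails for every $|z|\in(r_f,1)$.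
   Context: $\mathbb{D}=\{z\in\mathbb{C}:|z|<1\}$. $\mathcal{H}_0$ denotes the class of harmonic functions $f=h+\overline{g}$ on $\mathbb{D}$, where $h,g$ are analytic in $\mathbb{D}$ of the form $h(z)=z+\sum_{n=2}^\infty a_nz^n$ and $g(z)=\sum_{n=2}^\infty b_nz^n$. For $0\le\alpha<1$, $\mathcal{P}^{0}_{\mathcal{H}}(\alpha)$ is the set of $f=h+\overline{g}\in\mathcal{H}_0$ such that $\operatorname{Re}(h'(z)-\alpha)>|g'(z)|$ for all $z\in\mathbb{D}$. For a function $f$ on $\mathbb{D}$, $d(f(0),\partial f(\mathbb{D}))=\inf\{|w-f(0)|: w\in\partial f(\mathbb{D})\}$ is the Euclidean distance from $f(0)$ to the boundary of $f(\mathbb{D})$. *)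

(* Defs.v *)
From Stdlib Require Import Reals.
From Coquelicot Require Import Coquelicot.
Open Scope R_scope.

Definition harm (h g : C -> C) (z : C) : C := Cplus (h z) (Cconj (g z)).

Definition in_H0 (h g : C -> C) (a b : nat -> C) : Prop :=
  a 0%nat = RtoC 0 /\ a 1%nat = RtoC 1 /\ b 0%nat = RtoC 0 /\ b 1%nat = RtoC 0 /\
  (forall z : C, Cmod z < 1 -> is_pseries a z (h z) /\ is_pseries b z (g z)).

Definition in_PH0 (alpha : R) (h g : C -> C) (a b : nat -> C) : Prop :=
  in_H0 h g a b /\
  (forall z : C, Cmod z < 1 -> forall h' g' : C,
      is_derive h z h' -> is_derive g z g' -> Re h' - alpha > Cmod g').

Definition image_disk (f : C -> C) (w : C) : Prop :=
  exists z : C, Cmod z < 1 /\ w = f z.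

Definition boundary (S : C -> Prop) (w : C) : Prop :=
  (forall eps : R, 0 < eps -> exists s, S s /\ Cmod (Cminus s w) < eps) /\
  ~ (exists eps : R, 0 < eps /\ forall s, Cmod (Cminus s w) < eps -> S s).

(* d(f(0), boundary f(D)) as an extended real (+oo if the boundary is empty) *)
Definition dist_bdry (f : C -> C) : Rbar :=
  Glb_Rbar (fun x : R => exists w, boundary (image_disk f) w /\ x = Cmod (Cminus w (f (RtoC 0)))).

Definition bohr_sum (a b : nat -> C) (r : R) : R :=
  r + Series (fun n => (Cmod (a (n + 2)%nat) + Cmod (b (n + 2)%nat)) * r ^ (n + 2)).

Definition rf_eq (alpha r : R) : Prop :=
  r + 2 * (1 - alpha) * Series (fun n => r ^ (n + 2) / INR (n + 2)) =
  1 + 2 * (1 - alpha) * Series (fun n => (-1) ^ (n + 1) / INR (n + 2)).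

Definition coef_alpha (alpha : R) (n : nat) : C :=
  match n with
  | O => RtoC 0
  | S O => RtoC 1
  | _ => RtoC (2 * (1 - alpha) / INR n)
  end.

Definition zero_coef (n : nat) : C := RtoC 0.

(* Main.v *)
Require Import Defs.
From Stdlib Require Import Reals Ranalysis5 Lra Lia.
From Coquelicot Require Import Coquelicot.
Open Scope R_scope.

(** For unimodular [eps] the function [h' + eps g' - alpha] has positive real part.
    Pairing its boundary values with nonnegative trigonometric polynomials gives
    Caratheodory's bound [|a_n| + |b_n| <= 2 (1 - alpha) / n] and Harnack's inequality
    [Re h' - |g'| >= alpha + (1 - alpha) (1 - |z|) / (1 + |z|)].  The latter makes
    [f = h + conj g] a strongly monotone map of the plane on each smaller disc.
    Integrated along rays, it gives
    [Re (conj z f(z)) >= |z| (alpha |z| + (1 - alpha) (2 ln (1 + |z|) - |z|))];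
    hence for [|w|] below the value at [|z| = 1] of the second factor, a damped Picard
    iteration preserves some smaller disc and solves [f z = w].  So [f(D)] contains the
    disc around [f(0) = 0] whose radius is that value, the right-hand side of the
    equation for [r_f].  For the extremal function, minus this radius is a limit of
    values at real points tending to [-1], but it is not itself a value. *)

(** * Cosine series with nonnegative sum *)

(** The factor [eps] reduces a condition on two functions to one on a single function: a suitable
    argument, chosen anew for each coefficient or point, gives [a_n + eps b_n] the modulus |a_n| +
    |b_n|, or turns [eps g'(z)] into -|g'(z)|. The boundary values themselves are never formed. On a
    circle of radius r < 1 only partial sums of a cosine series are integrated, so orthogonality is
    a finite computation and truncation costs a geometric tail; the limits M -> oo and r -> 1 are
    then taken in numerical inequalities. The two test polynomials are 1 + cos(nt) and a truncated
    Poisson kernel lowered by its minimum. As [f] is not analytic, the covering statement cannot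
    rest on the open mapping theorem or the argument principle; monotonicity replaces both and makes
    the solution of f z = w constructive. Bounding the distance below by covering a disc also
    settles the case of an empty boundary, where the distance is +oo. *)

Definition cosine_sum (A : nat -> R) (M : nat) (t : R) : R :=
  sum_f_R0 (fun k => A k * cos (INR k * t)) M.

(** The squared norm of cos(kt) in L^2(0, PI). *)
Definition cosine_norm (k : nat) : R := match k with O => PI | _ => PI / 2 end.

Lemma is_RInt_eq (f : R -> R) (a b l l' : R) :
  is_RInt f a b l -> l = l' -> is_RInt f a b l'.
Proof. now intros H <-. Qed.

Lemma is_RInt_Rext (f g : R -> R) (a b l : R) :
  (forall x, f x = g x) -> is_RInt f a b l -> is_RInt g a b l.
Proof. intros H; apply is_RInt_ext; intros x _; apply H. Qed.

Lemma is_RInt_Rplus (f g : R -> R) (a b lf lg : R) :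
  is_RInt f a b lf -> is_RInt g a b lg -> is_RInt (fun t => f t + g t) a b (lf + lg).
Proof. exact (@is_RInt_plus R_NormedModule f g a b lf lg). Qed.

Lemma is_RInt_Rscal (f : R -> R) (k a b l : R) :
  is_RInt f a b l -> is_RInt (fun t => k * f t) a b (k * l).
Proof. exact (@is_RInt_scal R_NormedModule f a b k l). Qed.

Lemma is_RInt_cos (k : nat) :
  is_RInt (fun t => cos (INR k * t)) 0 PI (if Nat.eqb k 0 then PI else 0).
Proof.
  destruct k as [|k].
  - apply is_RInt_Rext with (fun _ => 1).
    + intros x. simpl INR. now rewrite Rmult_0_l, cos_0.
    + eapply is_RInt_eq; [exact (@is_RInt_const R_NormedModule 0 PI 1)|].
      change ((PI - 0) * 1 = PI). ring.
  - assert (Hk : 0 < INR (S k)) by (apply lt_0_INR; lia).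
    set (c := INR (S k)) in *.
    eapply is_RInt_eq.
    + apply (is_RInt_derive (fun t => sin (c * t) / c)
        (fun t => cos (c * t))).
      * intros x _. clearbody c. auto_derive; [lra|]. field; lra.
      * intros x _. apply (@ex_derive_continuous R_AbsRing). auto_derive; auto.
    + change (sin (c * PI) / c - sin (c * 0) / c = 0).
      rewrite Rmult_0_r, sin_0.
      replace (sin (c * PI)) with 0; [field; lra|].
      symmetry. unfold c; rewrite INR_IZR_INZ. apply sin_eq_0_1. now exists (Z.of_nat (S k)).
Qed.

Lemma is_RInt_cos_cos (k l : nat) :
  is_RInt (fun t => cos (INR k * t) * cos (INR l * t)) 0 PI
    (if Nat.eqb k l then cosine_norm k else 0).
Proof.
  (* The product-to-sum formula contains cos((k - l)t); for l <= k the natural-number subtraction is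
     exact, and the other case follows by symmetry. *)
  assert (H : forall k l, (l <= k)%nat ->
    is_RInt (fun t => cos (INR k * t) * cos (INR l * t)) 0 PI
    (if Nat.eqb k l then cosine_norm k else 0)).
  { clear; intros k l Hlk.
    apply is_RInt_Rext with
      (fun t => / 2 * (cos (INR (k + l) * t) + cos (INR (k - l) * t))).
    - intros x. rewrite plus_INR, minus_INR by lia.
      rewrite !Rmult_plus_distr_r, Rmult_minus_distr_r, cos_plus, cos_minus. field.
    - eapply is_RInt_eq; [apply is_RInt_Rscal, is_RInt_Rplus; apply is_RInt_cos|].
      destruct (Nat.eqb_spec k l) as [->|Hne].
      + rewrite Nat.sub_diag. simpl. destruct l; simpl; field.
      + replace (Nat.eqb (k + l) 0) with false by (symmetry; apply Nat.eqb_neq; lia).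
        replace (Nat.eqb (k - l) 0) with false by (symmetry; apply Nat.eqb_neq; lia).
        ring. }
  destruct (Nat.le_gt_cases l k) as [Hl|Hl]; [now apply H|].
  apply is_RInt_Rext with (fun t => cos (INR l * t) * cos (INR k * t)).
  - intros x. ring.
  - eapply is_RInt_eq; [apply H; lia|].
    destruct (Nat.eqb_spec l k); destruct (Nat.eqb_spec k l); subst; auto; lia.
Qed.

Lemma is_RInt_cosine_sum_cos (A : nat -> R) (M l : nat) :
  is_RInt (fun t => cosine_sum A M t * cos (INR l * t)) 0 PI
    (if Nat.leb l M then cosine_norm l * A l else 0).
Proof.
  induction M as [|M IH].
  - apply is_RInt_Rext with (fun t => A 0%nat * (cos (INR 0 * t) * cos (INR l * t))).
    + intros x. unfold cosine_sum; simpl; ring.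
    + eapply is_RInt_eq; [apply is_RInt_Rscal, is_RInt_cos_cos|].
      destruct l; simpl; ring.
  - apply is_RInt_Rext with (fun t => cosine_sum A M t * cos (INR l * t) +
      A (S M) * (cos (INR (S M) * t) * cos (INR l * t))).
    + intros x. unfold cosine_sum. rewrite tech5. ring.
    + eapply is_RInt_eq;
        [apply is_RInt_Rplus; [exact IH|apply is_RInt_Rscal, is_RInt_cos_cos]|].
      destruct (Nat.leb_spec l M); destruct (Nat.leb_spec l (S M));
          destruct (Nat.eqb_spec (S M) l); try lia; try ring.
      subst l; ring.
Qed.

(** Separate lengths let the induction on [N] keep [M] fixed; [N <= M] makes every frequency of the
    second sum occur in the first. *)
Lemma is_RInt_cosine_sum_mult (A T : nat -> R) (M N : nat) : (N <= M)%nat ->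
  is_RInt (fun t => cosine_sum A M t * cosine_sum T N t) 0 PI
    (sum_f_R0 (fun l => cosine_norm l * A l * T l) N).
Proof.
  induction N as [|N IH]; intros HN.
  - apply is_RInt_Rext with (fun t => T 0%nat * (cosine_sum A M t * cos (INR 0 * t))).
    + intros x. change (cosine_sum T 0 x) with (T 0%nat * cos (INR 0 * x)). ring.
    + eapply is_RInt_eq; [apply is_RInt_Rscal, is_RInt_cosine_sum_cos|].
      simpl; ring.
  - apply is_RInt_Rext with (fun t => cosine_sum A M t * cosine_sum T N t +
      T (S N) * (cosine_sum A M t * cos (INR (S N) * t))).
    + intros x. change (cosine_sum T (S N) x) with
        (cosine_sum T N x + T (S N) * cos (INR (S N) * x)). ring.
    + eapply is_RInt_eq; [apply is_RInt_Rplus;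
        [apply IH; lia|apply is_RInt_Rscal, is_RInt_cosine_sum_cos]|].
      rewrite tech5.
      replace (Nat.leb (S N) M) with true by (symmetry; apply Nat.leb_le; lia). ring.
Qed.

(** The product of the nonnegative functions [cosine_sum A M + eps] and [cosine_sum T M] has a
    nonnegative integral, and orthogonality evaluates it. *)
Lemma cosine_sum_pairing_ge0 (A T : nat -> R) (M : nat) (eps : R) :
  (forall t, - eps <= cosine_sum A M t) -> (forall t, 0 <= cosine_sum T M t) ->
  0 <= sum_f_R0 (fun l => cosine_norm l * A l * T l) M + eps * (PI * T 0%nat).
Proof.
  intros HA HT.
  apply (is_RInt_ge_0 (fun t => cosine_sum A M t * cosine_sum T M t +
     eps * (cosine_sum T M t * cos (INR 0 * t))) 0 PI).
  - generalize PI_RGT_0; lra.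
  - apply is_RInt_Rplus.
    + now apply is_RInt_cosine_sum_mult.
    + apply is_RInt_Rscal. exact (is_RInt_cosine_sum_cos T M 0).
  - intros t _. specialize (HA t). specialize (HT t).
    simpl. rewrite Rmult_0_l, cos_0. nra.
Qed.

Lemma Rabs_cos_le1 (x : R) : Rabs (cos x) <= 1.
Proof. apply Rabs_le, COS_bound. Qed.

Lemma is_lim_seq_geom_scal (k rho : R) : Rabs rho < 1 ->
  is_lim_seq (fun n => k * rho ^ S n) 0.
Proof.
  intros H. replace (Finite 0) with (Rbar_mult k (rho * 0)) by (simpl; f_equal; ring).
  apply is_lim_seq_scal_l. simpl pow.
  apply (is_lim_seq_scal_l (fun n => rho ^ n) rho 0). now apply is_lim_seq_geom.
Qed.

Lemma is_series_Rscal (k : R) (a : nat -> R) (l : R) :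
  is_series a l -> is_series (fun n => k * a n) (k * l).
Proof. exact (is_series_scal_l k a l). Qed.

Lemma is_series_Rext (a b : nat -> R) (l : R) :
  (forall n, a n = b n) -> is_series a l -> is_series b l.
Proof. exact (is_series_ext a b l). Qed.

(** Truncated form of the Poisson kernel identity (1 - 2q cos t + q^2)(1 + 2 sum_{k>=1} q^k cos kt)
    = 1 - q^2; the subtracted 1 corrects the doubled term k = 0, and the last two terms are the
    truncation error. *)
Lemma poisson_sum_identity (q t : R) (M : nat) :
  (1 - 2 * q * cos t + q ^ 2) *
     (2 * cosine_sum (fun k => q ^ k) M t - 1) =
  1 - q ^ 2 - 2 * q ^ S M * cos (INR (S M) * t) + 2 * q ^ S (S M) * cos (INR M * t).
Proof.
  induction M as [|M IH].
  - unfold cosine_sum. simpl. rewrite Rmult_0_l, cos_0, (Rmult_1_l t). ring.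
  - unfold cosine_sum in *. rewrite tech5.
    assert (Hc : cos (INR (S (S M)) * t) = 2 * cos t * cos (INR (S M) * t) - cos (INR M * t)).
    { rewrite !S_INR.
      replace ((INR M + 1 + 1) * t) with ((INR M + 1) * t + t) by ring.
      replace (INR M * t) with ((INR M + 1) * t - t) by ring.
      rewrite cos_plus, cos_minus. ring. }
    rewrite Hc.
    transitivity ((1 - 2 * q * cos t + q ^ 2) *
     (2 * sum_f_R0 (fun k : nat => q ^ k * cos (INR k * t)) M - 1) +
      (1 - 2 * q * cos t + q ^ 2) * 2 * q ^ S M * cos (INR (S M) * t)).
    { ring. }
    rewrite IH. simpl pow. ring.
Qed.

(** The factor [D] lies between (1 - q)^2 and (1 + q)^2. The upper bound gives the minimum (1 -
    q)/(1 + q) of the full kernel, reached at t = PI; the lower one controls the truncation error,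
    whose numerator is at most 4 q^(M+1). *)
Lemma poisson_sum_ge (q t : R) (M : nat) : 0 <= q < 1 ->
  (1 - q) / (1 + q) - 4 / (1 - q) ^ 2 * q ^ S M <= 2 * cosine_sum (fun k => q ^ k) M t - 1.
Proof.
  intros Hq. generalize (poisson_sum_identity q t M).
  set (X := 2 * _ - 1). set (D := 1 - 2 * q * cos t + q ^ 2).
  intros HX. generalize (COS_bound t), (COS_bound (INR (S M) * t)), (COS_bound (INR M * t)).
  intros H0 H1 H2.
  assert (HD1 : (1 - q) ^ 2 <= D) by (unfold D; nra).
  assert (HD2 : D <= (1 + q) ^ 2) by (unfold D; nra).
  assert (Hp : 0 < (1 - q) ^ 2) by nra.
  assert (Hqm : 0 <= q ^ S M) by (apply pow_le; lra).
  assert (HR : 1 - q ^ 2 - 4 * q ^ S M <= D * X).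
  { rewrite HX. change (q ^ S (S M)) with (q * q ^ S M).
    set (y := q ^ S M) in *. clearbody y.
    assert (y * cos (INR (S M) * t) <= y) by nra.
    assert (- y <= q * (y * cos (INR M * t))).
    { assert (- y <= y * cos (INR M * t)) by nra. nra. }
    lra. }
  apply Rmult_le_reg_l with D; [lra|]. eapply Rle_trans; [|exact HR].
  unfold Rminus at 1. rewrite Rmult_plus_distr_l.
  assert (E1 : D * ((1 - q) / (1 + q)) <= 1 - q ^ 2).
  { replace (1 - q ^ 2) with ((1 + q) ^ 2 * ((1 - q) / (1 + q))) by (field; lra).
    apply Rmult_le_compat_r; [|exact HD2]. apply Rle_mult_inv_pos; lra. }
  assert (E2 : 4 * q ^ S M <= D * (4 / (1 - q) ^ 2 * q ^ S M)).
  { replace (4 * q ^ S M) with ((1 - q) ^ 2 * (4 / (1 - q) ^ 2 * q ^ S M)) at 1 by (field; lra).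
    apply Rmult_le_compat_r; [|exact HD1].
    apply Rmult_le_pos; [|exact Hqm]. apply Rle_mult_inv_pos; lra. }
  lra.
Qed.

(** * Coefficient bound and Harnack inequality for a nonnegative cosine series *)

Section CosineSeries.

Variables (A : nat -> R) (K rho : R).
Hypothesis Hrho : 0 <= rho < 1.
Hypothesis HA : forall k, Rabs (A k) <= K * rho ^ k.
Hypothesis Hpos : forall t l : R, is_series (fun k => A k * cos (INR k * t)) l -> 0 <= l.

(** The sum of K rho^k over k > M, which bounds what the partial sum up to [M] omits. *)
Definition geometric_tail (M : nat) : R := K / (1 - rho) * rho ^ S M.

Lemma cosine_sum_ge (M : nat) (t : R) : - geometric_tail M <= cosine_sum A M t.
Proof.
  set (u := fun k => A k * cos (INR k * t)).
  assert (Hu : forall k, norm (u k) <= K * rho ^ k).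
  { intros k. unfold norm; simpl; unfold abs; simpl. unfold u.
    rewrite Rabs_mult. generalize (Rabs_cos_le1 (INR k * t)), (Rabs_pos (A k)), (HA k),
      (Rabs_pos (cos (INR k * t))). nra. }
  assert (Hg : is_series (fun k => K * rho ^ k) (K * / (1 - rho))).
  { apply is_series_Rscal, is_series_geom. rewrite Rabs_pos_eq; lra. }
  assert (Hex : ex_series u).
  { apply (@ex_series_le R_AbsRing R_CompleteNormedModule) with (fun k => K * rho ^ k); auto.
    now eexists; apply Hg. }
  set (l := Series u). assert (Hl : is_series u l) by now apply Series_correct.
  generalize (Hpos t l Hl); intros Hl0.
  assert (Ht : is_series (fun k => u (S M + k)%nat) (l - cosine_sum A M t)).
  { generalize (is_series_incr_n u (S M) (l - cosine_sum A M t) ltac:(lia)). intros Hi.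
    apply Hi. simpl pred. rewrite sum_n_Reals.
    change (is_series u (l - cosine_sum A M t + cosine_sum A M t)).
    now replace (l - cosine_sum A M t + cosine_sum A M t) with l by ring. }
  assert (Ht2 : is_series (fun k => K * rho ^ (S M + k)) (geometric_tail M)).
  { unfold geometric_tail. replace (K / (1 - rho) * rho ^ S M) with (K * rho ^ S M * / (1 - rho))
      by (field; lra).
    apply is_series_Rext with (fun k => K * rho ^ S M * rho ^ k).
    - intros k. rewrite pow_add. ring.
    - apply is_series_Rscal, is_series_geom. rewrite Rabs_pos_eq; lra. }
  assert (l - cosine_sum A M t <= geometric_tail M); [|lra].
  rewrite <- (is_series_unique _ _ Ht), <- (is_series_unique _ _ Ht2).
  apply Rle_trans with (Series (fun k => Rabs (u (S M + k)%nat))).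
  - eapply Rle_trans; [apply Rle_abs|]. apply Series_Rabs.
    apply (@ex_series_le R_AbsRing R_CompleteNormedModule)
      with (fun k => K * rho ^ (S M + k)); [|now exists (geometric_tail M)].
    intros k. unfold norm; simpl; unfold abs; simpl. rewrite Rabs_Rabsolu. apply (Hu (S M + k)%nat).
  - apply Series_le; [|now exists (geometric_tail M)].
    intros k; split; [apply Rabs_pos|apply (Hu (S M + k)%nat)].
Qed.

Lemma is_lim_seq_tail : is_lim_seq geometric_tail 0.
Proof. apply is_lim_seq_geom_scal. rewrite Rabs_pos_eq; lra. Qed.

(** Pairing with the nonnegative polynomial 1 + cos(nt) gives PI A_0 + (PI/2) A_n, up to a tail that
    tends to 0. *)
Lemma cosine_series_coef_ge (n : nat) : (1 <= n)%nat -> 0 <= 2 * A 0%nat + A n.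
Proof.
  intros Hn.
  set (T := fun k => if Nat.eqb k 0 then 1 else if Nat.eqb k n then 1 else 0).
  assert (Hsum : forall (w : nat -> R) M,
     sum_f_R0 (fun k => w k * T k) M = w 0%nat + if Nat.leb n M then w n else 0).
  { intros w M. induction M as [|M IH].
    - simpl. unfold T. simpl. destruct n; [lia|]. simpl. ring.
    - rewrite tech5, IH. unfold T. destruct (Nat.eqb_spec (S M) 0); [lia|].
      destruct (Nat.eqb_spec (S M) n); destruct (Nat.leb_spec n M);
        destruct (Nat.leb_spec n (S M)); try lia; subst; ring. }
  assert (Hle : forall M, (n <= M)%nat -> 0 <= (2 * A 0%nat + A n) + 2 * geometric_tail M).
  { intros M HM.
    generalize (cosine_sum_pairing_ge0 A T M (geometric_tail M) (cosine_sum_ge M)). intros H.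
    assert (HT : forall t, 0 <= cosine_sum T M t).
    { intros t. unfold cosine_sum.
      rewrite (sum_eq _ (fun k => cos (INR k * t) * T k)) by (intros; ring).
      rewrite (Hsum (fun k => cos (INR k * t))).
      replace (Nat.leb n M) with true by (symmetry; now apply Nat.leb_le).
      simpl INR. rewrite Rmult_0_l, cos_0. generalize (COS_bound (INR n * t)); lra. }
    specialize (H HT). rewrite (Hsum (fun k => cosine_norm k * A k)) in H.
    replace (Nat.leb n M) with true in H by (symmetry; now apply Nat.leb_le).
    unfold T in H. simpl in H. destruct n as [|n']; [lia|]. simpl in H.
    generalize PI_RGT_0; intros HP.
    apply Rmult_le_reg_l with (PI / 2); [lra|]. rewrite Rmult_0_r.
    replace (PI / 2 * (2 * A 0%nat + A (S n') + 2 * geometric_tail M)) with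
      (PI * A 0%nat + PI / 2 * A (S n') + geometric_tail M * (PI * 1)) by field. exact H. }
  (* The shift by [n] makes every index large enough for the polynomial to contain the frequency
     [n]. *)
  assert (Hlim : is_lim_seq (fun M => (2 * A 0%nat + A n) + 2 * geometric_tail (M + n)) (2 * A 0%nat + A n)).
  { replace (Finite (2 * A 0%nat + A n)) with (Finite (2 * A 0%nat + A n + 2 * 0)) by (f_equal; ring).
    apply is_lim_seq_plus'; [apply is_lim_seq_const|].
    apply (is_lim_seq_scal_l (fun M => geometric_tail (M + n)) 2 0).
    apply (is_lim_seq_incr_n geometric_tail n 0), is_lim_seq_tail. }
  refine (is_lim_seq_le (fun _ => 0) _ 0 _ _ (is_lim_seq_const 0) Hlim).
  intros M; apply Hle; lia.
Qed.

(** The Poisson kernel minus its minimum is still nonnegative, hence an admissible weight; pairing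
    with it yields PI (S - A_0 (1 - q)/(1 + q)). *)
Lemma cosine_series_harnack (q S : R) : 0 <= q < 1 ->
  is_series (fun k => A k * q ^ k) S -> A 0%nat * ((1 - q) / (1 + q)) <= S.
Proof.
  intros Hq HS.
  set (del := fun M => 4 / (1 - q) ^ 2 * q ^ Datatypes.S M).
  set (c := (1 - q) / (1 + q)).
  assert (Hle : forall M, 0 <= sum_n (fun k => A k * q ^ k) M
      + A 0%nat * (del M - c) + geometric_tail M * (1 - c + del M)).
  { intros M.
    (* The truncated kernel, lowered by its minimum [c] and raised by the truncation error [del M]
       to stay nonnegative. *)
    set (T := fun k => if Nat.eqb k 0 then 1 - c + del M else 2 * q ^ k).
    assert (HT : forall (w : nat -> R) N, sum_f_R0 (fun k => w k * T k) N =
       2 * sum_f_R0 (fun k => w k * q ^ k) N + w 0%nat * (del M - c - 1)).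
    { intros w N. induction N as [|N IH]; [unfold T; simpl; ring|].
      rewrite !tech5, IH. unfold T. simpl Nat.eqb. cbv iota. ring. }
    generalize (cosine_sum_pairing_ge0 A T M (geometric_tail M) (cosine_sum_ge M)). intros H.
    assert (HTp : forall t, 0 <= cosine_sum T M t).
    { intros t. unfold cosine_sum.
      rewrite (sum_eq _ (fun k => cos (INR k * t) * T k)) by (intros; ring).
      rewrite (HT (fun k => cos (INR k * t))).
      rewrite (sum_eq _ (fun k => q ^ k * cos (INR k * t))) by (intros; ring).
      simpl INR. rewrite Rmult_0_l, cos_0.
      generalize (poisson_sum_ge q t M Hq). unfold cosine_sum. fold c. unfold del. lra. }
    specialize (H HTp). rewrite (HT (fun k => cosine_norm k * A k)) in H.
    assert (Hw : forall N, 2 * sum_f_R0 (fun k => cosine_norm k * A k * q ^ k) N =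
       PI * sum_f_R0 (fun k => A k * q ^ k) N + PI * A 0%nat).
    { intros N. induction N as [|N IH]; [simpl; ring|].
      rewrite !tech5, Rmult_plus_distr_l, IH. simpl cosine_norm. field. }
    rewrite Hw in H. simpl cosine_norm in H. unfold T in H. simpl Nat.eqb in H. cbv iota in H.
    generalize PI_RGT_0; intros HP.
    rewrite sum_n_Reals.
    apply Rmult_le_reg_l with PI; [lra|]. rewrite Rmult_0_r.
    eapply Rle_trans; [exact H|]. apply Req_le. ring. }
  assert (Hd : is_lim_seq del 0).
  { apply is_lim_seq_geom_scal. rewrite Rabs_pos_eq; lra. }
  assert (Hlim : is_lim_seq (fun M => sum_n (fun k => A k * q ^ k) M
      + A 0%nat * (del M - c) + geometric_tail M * (1 - c + del M)) (S + A 0%nat * (0 - c) + 0 * (1 - c + 0))).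
  { apply is_lim_seq_plus'; [apply is_lim_seq_plus'|].
    - exact HS.
    - apply is_lim_seq_mult'; [apply is_lim_seq_const|].
      apply is_lim_seq_minus'; [exact Hd|apply is_lim_seq_const].
    - apply is_lim_seq_mult'; [apply is_lim_seq_tail|].
      apply is_lim_seq_plus'; [apply is_lim_seq_const|exact Hd]. }
  generalize (is_lim_seq_le (fun _ => 0) _ 0 _ Hle (is_lim_seq_const 0) Hlim).
  simpl. lra.
Qed.

End CosineSeries.

(** * Complex power series *)

Lemma pow_n_Cpow (z : C) (n : nat) : pow_n z n = (z ^ n)%C.
Proof. induction n as [|n IH]; [reflexivity|]. simpl. now rewrite IH. Qed.

Lemma is_pseries_Cseries (a : nat -> C) (z l : C) :
  is_pseries a z l <-> is_series (fun k => (z ^ k * a k)%C) l.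
Proof.
  split; apply is_series_ext; intros n; rewrite <- pow_n_Cpow; reflexivity.
Qed.

Lemma sum_n_C (u : nat -> C) (n : nat) :
  sum_n u n = (sum_n (fun k => Re (u k)) n, sum_n (fun k => Im (u k)) n).
Proof.
  induction n as [|n IH].
  - rewrite !sum_O. now destruct (u 0%nat).
  - rewrite !sum_Sn, IH. reflexivity.
Qed.

Lemma is_series_C (u : nat -> C) (l : C) :
  is_series u l <->
  is_series (fun k => Re (u k)) (Re l) /\ is_series (fun k => Im (u k)) (Im l).
Proof.
  unfold is_series. split.
  - intros H. split; apply filterlim_locally; intros eps;
    generalize (proj1 (filterlim_locally _ _) H eps); apply filter_imp;
    intros n Hn; rewrite sum_n_C in Hn; apply Hn.
  - intros [H1 H2]. apply filterlim_locally. intros eps.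
    generalize (filter_and _ _ (proj1 (filterlim_locally _ _) H1 eps)
      (proj1 (filterlim_locally _ _) H2 eps)). apply filter_imp.
    intros n Hn. rewrite sum_n_C. exact Hn.
Qed.

Lemma Cmod_is_series_le (u : nat -> C) (v : nat -> R) (l : C) (L : R) :
  is_series u l -> is_series v L -> (forall n, Cmod (u n) <= v n) -> Cmod l <= L.
Proof.
  intros Hu Hv Huv.
  assert (H1 : is_lim_seq (fun n => Cmod (sum_n u n)) (Cmod l)).
  { apply (filterlim_comp _ _ _ (sum_n u) (@norm _ C_NormedModule) eventually (locally l)).
    - exact Hu.
    - apply (@filterlim_norm C_AbsRing C_NormedModule). }
  refine (is_lim_seq_le _ _ (Finite (Cmod l)) (Finite L) _ H1 Hv).
  intros n. induction n as [|n IH].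
  - rewrite !sum_O. apply Huv.
  - rewrite !sum_Sn. eapply Rle_trans; [apply Cmod_triangle|].
    apply Rplus_le_compat; [exact IH|apply Huv].
Qed.

Lemma ex_series_C_le (u : nat -> C) (v : nat -> R) :
  (forall n, Cmod (u n) <= v n) -> ex_series v -> exists l : C, is_series u l.
Proof.
  intros H Hv. apply (@ex_series_le C_AbsRing C_CompleteNormedModule u v H Hv).
Qed.

Lemma Cmod_le_Re_Im (z : C) : Cmod z <= Rabs (Re z) + Rabs (Im z).
Proof.
  generalize (Rabs_pos (Re z)), (Rabs_pos (Im z)); intros H1 H2.
  apply Rsqr_incr_0; [|apply Cmod_ge_0|lra].
  unfold Rsqr. replace (Cmod z * Cmod z) with (Cmod z ^ 2) by ring.
  rewrite Cmod2_alt. rewrite <- (pow2_abs (Re z)), <- (pow2_abs (Im z)). nra.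
Qed.

Lemma is_series_C_bounded (u : nat -> C) (l : C) :
  is_series u l -> exists K, forall n, Cmod (u n) <= K.
Proof.
  intros H. apply is_series_C in H. destruct H as [H1 H2].
  assert (B : forall v : nat -> R, ex_series v -> exists K, forall n, Rabs (v n) <= K).
  { intros v Hv. destruct (maj_by_pos v) as [K [_ HK]]; [|now exists K].
    exists 0. apply is_lim_seq_Reals; now apply ex_series_lim_0. }
  destruct (B _ (ex_intro _ _ H1)) as [K1 HK1].
  destruct (B _ (ex_intro _ _ H2)) as [K2 HK2].
  exists (K1 + K2). intros n. eapply Rle_trans; [apply Cmod_le_Re_Im|].
  apply Rplus_le_compat; auto.
Qed.

(** [rho ^ n / rho] stands for rho^(n-1), so that n = 0 needs no separate form. *)
Lemma Cpow_sub_le (rho : R) (z w : C) (n : nat) :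
  0 < rho -> Cmod z <= rho -> Cmod w <= rho ->
  Cmod (w ^ n - z ^ n) <= INR n * rho ^ n / rho * Cmod (w - z).
Proof.
  intros Hr Hz Hw. induction n as [|n IH].
  - simpl. replace (1 - 1)%C with (RtoC 0) by ring. rewrite Cmod_0.
    unfold Rdiv. rewrite !Rmult_0_l. lra.
  - replace (w ^ S n - z ^ S n)%C with (w * (w ^ n - z ^ n) + z ^ n * (w - z))%C
      by (simpl; ring).
    eapply Rle_trans; [apply Cmod_triangle|]. rewrite !Cmod_mult, Cmod_pow, S_INR.
    assert (H1 : Cmod z ^ n <= rho ^ n)
      by (apply pow_incr; split; [apply Cmod_ge_0|exact Hz]).
    generalize (Cmod_ge_0 (w - z)), (Cmod_ge_0 w), (Cmod_ge_0 (w ^ n - z ^ n)). intros P1 P2 P3.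
    replace ((INR n + 1) * rho ^ S n / rho * Cmod (w - z)) with
      (rho * (INR n * rho ^ n / rho * Cmod (w - z)) + rho ^ n * Cmod (w - z))
      by (simpl; field; lra).
    apply Rplus_le_compat; [|now apply Rmult_le_compat_r].
    now apply Rmult_le_compat.
Qed.

Lemma Cpow_taylor_le (rho : R) (z w : C) (n : nat) :
  0 < rho -> Cmod z <= rho -> Cmod w <= rho ->
  Cmod (w ^ n - z ^ n - RtoC (INR n) * z ^ pred n * (w - z)) <=
    INR n ^ 2 * rho ^ n / rho ^ 2 * Cmod (w - z) ^ 2.
Proof.
  intros Hr Hz Hw. induction n as [|n IH].
  - replace (w ^ 0 - z ^ 0 - RtoC (INR 0) * z ^ pred 0 * (w - z))%C with (RtoC 0)
      by (simpl; ring).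
    rewrite Cmod_0. simpl INR. apply Req_le. field; lra.
  - assert (E : (w ^ S n - z ^ S n - RtoC (INR (S n)) * z ^ pred (S n) * (w - z))%C =
       (w * (w ^ n - z ^ n - RtoC (INR n) * z ^ pred n * (w - z)) +
        RtoC (INR n) * z ^ pred n * (w - z) ^ 2)%C).
    { rewrite S_INR, RtoC_plus. destruct n as [|n]; simpl; ring. }
    rewrite E. eapply Rle_trans; [apply Cmod_triangle|].
    rewrite !Cmod_mult, !Cmod_pow, Cmod_R, (Rabs_pos_eq (INR n)) by apply pos_INR.
    assert (H1 : INR n * Cmod z ^ pred n <= INR n * rho ^ n / rho).
    { destruct n as [|n]; [simpl; apply Req_le; field; lra|].
      replace (INR (S n) * rho ^ S n / rho) with (INR (S n) * rho ^ n)
        by (simpl pow; field; lra).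
      apply Rmult_le_compat_l; [apply pos_INR|]. simpl pred.
      apply pow_incr; split; [apply Cmod_ge_0|exact Hz]. }
    set (d := Cmod (w - z)) in *.
    generalize (Cmod_ge_0 w), (pos_INR n), (pow_lt rho n Hr), (pow2_ge_0 d). intros P1 P2 P3 P4.
    apply Rle_trans with
      (rho * (INR n ^ 2 * rho ^ n / rho ^ 2 * d ^ 2) + INR n * rho ^ n / rho * d ^ 2).
    + apply Rplus_le_compat; [|now apply Rmult_le_compat_r].
      apply Rmult_le_compat; auto. apply Cmod_ge_0.
    + replace (rho * (INR n ^ 2 * rho ^ n / rho ^ 2 * d ^ 2) + INR n * rho ^ n / rho * d ^ 2)
        with ((INR n ^ 2 + INR n) * (rho ^ n / rho * d ^ 2)) by (field; lra).
      replace (INR (S n) ^ 2 * rho ^ S n / rho ^ 2 * d ^ 2)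
        with (INR (S n) ^ 2 * (rho ^ n / rho * d ^ 2)) by (simpl pow; field; lra).
      apply Rmult_le_compat_r.
      * apply Rmult_le_pos; [|exact P4]. apply Rle_mult_inv_pos; lra.
      * rewrite S_INR. nra.
Qed.

(** Bernoulli gives (n + 1) d <= (1 + d)^n for d <= 1, so the quadratic factor is absorbed by (1 +
    d)^(2n); the choice d = (1 - x)/4 keeps x (1 + d)^2 below 1. *)
Lemma sqr_geom_le (x : R) : 0 <= x < 1 ->
  exists K y, 0 <= K /\ 0 <= y < 1 /\ forall n, (INR n + 1) ^ 2 * x ^ n <= K * y ^ n.
Proof.
  intros Hx. set (d := (1 - x) / 4).
  assert (Hd : 0 < d <= 1) by (unfold d; lra).
  assert (Hxd : x = 1 - 4 * d) by (unfold d; field).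
  exists (/ d ^ 2), (x * (1 + d) ^ 2). split; [|split].
  - apply Rlt_le, Rinv_0_lt_compat. nra.
  - split; [apply Rmult_le_pos; [lra|apply pow2_ge_0]|]. rewrite Hxd. nra.
  - intros n. assert (Hb : (INR n + 1) * d <= (1 + d) ^ n).
    { apply Rle_trans with (1 + INR n * d); [nra|]. apply poly. lra. }
    rewrite Rpow_mult_distr, <- pow_mult, Nat.mul_comm, pow_mult.
    assert (Hn : 0 <= INR n) by apply pos_INR.
    assert (H2 : ((INR n + 1) * d) ^ 2 <= ((1 + d) ^ n) ^ 2).
    { apply pow_incr. split; [|exact Hb]. apply Rmult_le_pos; lra. }
    replace ((INR n + 1) ^ 2 * x ^ n) with (/ d ^ 2 * (x ^ n * ((INR n + 1) * d) ^ 2))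
      by (field; lra).
    apply Rmult_le_compat_l; [apply Rlt_le, Rinv_0_lt_compat; nra|].
    apply Rmult_le_compat_l; [apply pow_le; lra|exact H2].
Qed.

(** * Derivative, Lipschitz bound and Taylor remainder of a power series *)

Section PowerSeries.

Variables (a : nat -> C) (h : C -> C).
Hypothesis Hh : forall z, Cmod z < 1 -> is_pseries a z (h z).

(** Convergence at a point s between rho and 1 bounds |a_n| s^n, which leaves the ratio (rho/s)^n to
    absorb the factor (n + 1)^2. The square is what the Taylor remainder needs. *)
Lemma pseries_coef_sqr_le (rho : R) : 0 < rho < 1 ->
  exists K y, 0 <= K /\ 0 <= y < 1 /\
    forall n, (INR n + 1) ^ 2 * (Cmod (a n) * rho ^ n) <= K * y ^ n.
Proof.
  intros Hr. set (s := (1 + rho) / 2).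
  assert (Hs : rho < s < 1) by (unfold s; lra).
  assert (Hs' : is_series (fun k => (RtoC s ^ k * a k)%C) (h (RtoC s))).
  { apply is_pseries_Cseries, Hh. rewrite Cmod_R, Rabs_pos_eq; lra. }
  destruct (is_series_C_bounded _ _ Hs') as [B HB].
  destruct (sqr_geom_le (rho / s)) as [K [y [HK [Hy Hle]]]].
  { split; [apply Rle_mult_inv_pos; lra|].
    apply Rmult_lt_reg_r with s; [lra|]. field_simplify; lra. }
  assert (HB0 : 0 <= B) by (eapply Rle_trans; [apply Cmod_ge_0|apply (HB 0%nat)]).
  exists (B * K), y. split; [|split]; auto; [now apply Rmult_le_pos|].
  intros n. specialize (HB n). specialize (Hle n).
  rewrite Cmod_mult, Cmod_pow, Cmod_R, Rabs_pos_eq in HB by lra.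
  assert (Hsn : 0 < s ^ n) by (apply pow_lt; lra).
  replace ((INR n + 1) ^ 2 * (Cmod (a n) * rho ^ n)) with
    ((s ^ n * Cmod (a n)) * ((INR n + 1) ^ 2 * (rho / s) ^ n)).
  - replace (B * K * y ^ n) with (B * (K * y ^ n)) by ring.
    apply Rmult_le_compat; auto.
    + apply Rmult_le_pos; [lra|apply Cmod_ge_0].
    + apply Rmult_le_pos; [apply pow2_ge_0|apply pow_le, Rle_mult_inv_pos; lra].
  - unfold Rdiv. rewrite Rpow_mult_distr, pow_inv. field. lra.
Qed.

Definition dcoef (n : nat) : C := (RtoC (INR (S n)) * a (S n))%C.

(** The candidate for h'(z), built from the total real [Series] so that it is defined without a
    convergence proof. *)
Definition dsum (z : C) : C :=
  (Series (fun k => Re (z ^ k * dcoef k)%C), Series (fun k => Im (z ^ k * dcoef k)%C)).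

Lemma is_series_geom_scal (K y : R) : 0 <= y < 1 ->
  is_series (fun n => K * y ^ n) (K * / (1 - y)).
Proof.
  intros Hy. apply is_series_Rscal, is_series_geom. rewrite Rabs_pos_eq; lra.
Qed.

Lemma is_pseries_dsum (z : C) : Cmod z < 1 -> is_pseries dcoef z (dsum z).
Proof.
  intros Hz. apply is_pseries_Cseries.
  set (rho := Rmax (Cmod z) (/ 2)).
  assert (Hr : 0 < rho < 1).
  { unfold rho. generalize (Rmax_r (Cmod z) (/ 2)). split; [lra|].
    apply Rmax_lub_lt; lra. }
  assert (Hzr : Cmod z <= rho) by apply Rmax_l.
  destruct (pseries_coef_sqr_le rho Hr) as [K [y [HK [Hy Hle]]]].
  destruct (ex_series_C_le (fun k => (z ^ k * dcoef k)%C) (fun n => K * y / rho * y ^ n)) as [l Hl].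
  - intros n. unfold dcoef. rewrite !Cmod_mult, Cmod_pow, Cmod_R, Rabs_pos_eq by apply pos_INR.
    specialize (Hle (S n)).
    apply Rle_trans with ((INR (S n) + 1) ^ 2 * (Cmod (a (S n)) * rho ^ S n) / rho).
    + replace ((INR (S n) + 1) ^ 2 * (Cmod (a (S n)) * rho ^ S n) / rho) with
        (rho ^ n * ((INR (S n) + 1) ^ 2 * Cmod (a (S n)))) by (simpl pow; field; lra).
      generalize (pos_INR (S n)), (Cmod_ge_0 (a (S n))), (Cmod_ge_0 z). intros P1 P2 P3.
      apply Rmult_le_compat.
      * now apply pow_le.
      * now apply Rmult_le_pos.
      * apply pow_incr; lra.
      * apply Rmult_le_compat_r; [exact P2|nra].
    + replace (K * y / rho * y ^ n) with (K * y ^ S n / rho) by (simpl; field; lra).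
      apply Rmult_le_compat_r; [|exact Hle]. apply Rlt_le, Rinv_0_lt_compat; lra.
  - eexists. now apply is_series_geom_scal.
  - assert (E : dsum z = l); [|now rewrite E].
    apply is_series_C in Hl. destruct Hl as [H1 H2]. unfold dsum.
    rewrite (is_series_unique _ _ H1), (is_series_unique _ _ H2). now destruct l.
Qed.

(** The same sum indexed like the series of [h], for termwise subtraction; the added term n = 0
    vanishes since [INR 0] is 0. *)
Lemma is_series_dsum_pred (z : C) : Cmod z < 1 ->
  is_series (fun n => (RtoC (INR n) * z ^ pred n * a n)%C) (dsum z).
Proof.
  intros Hz. apply is_series_decr_1.
  replace (plus (dsum z) _) with (dsum z).
  - generalize (proj1 (is_pseries_Cseries _ _ _) (is_pseries_dsum z Hz)).
    apply is_series_ext. intros n. unfold dcoef. simpl pred.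
    change ((z ^ n * (RtoC (INR (S n)) * a (S n)))%C = (RtoC (INR (S n)) * z ^ n * a (S n))%C). ring.
  - change (dsum z = (dsum z + - (RtoC (INR 0) * z ^ 0 * a 0%nat))%C). simpl INR. ring.
Qed.

Lemma pseries_lipschitz (rho : R) : 0 < rho < 1 ->
  exists B, 0 <= B /\ forall z w, Cmod z <= rho -> Cmod w <= rho ->
    Cmod (h w - h z) <= B * Cmod (w - z).
Proof.
  intros Hr. destruct (pseries_coef_sqr_le rho Hr) as [K [y [HK [Hy Hle]]]].
  exists (K / rho * / (1 - y)). split.
  { apply Rmult_le_pos; [apply Rle_mult_inv_pos; lra|]. apply Rlt_le, Rinv_0_lt_compat; lra. }
  intros z w Hz Hw.
  assert (S1 : is_series (fun n => (w ^ n * a n - z ^ n * a n)%C) (h w - h z)%C).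
  { apply (@is_series_minus C_AbsRing C_NormedModule);
      apply is_pseries_Cseries, Hh; lra. }
  set (d := Cmod (w - z)).
  replace (K / rho * / (1 - y) * d) with (K / rho * d * / (1 - y)) by ring.
  apply (Cmod_is_series_le _ (fun n => K / rho * d * y ^ n) _ _ S1).
  { now apply is_series_geom_scal. }
  intros n. replace (w ^ n * a n - z ^ n * a n)%C with ((w ^ n - z ^ n) * a n)%C by ring.
  rewrite Cmod_mult. generalize (Cmod_ge_0 (a n)), (Cmod_ge_0 (w - z)), (pos_INR n). fold d. intros P1 P2 P3.
  eapply Rle_trans; [apply Rmult_le_compat_r;
    [exact P1|apply (Cpow_sub_le rho); auto; lra]|]. fold d.
  replace (INR n * rho ^ n / rho * d * Cmod (a n)) with
    (INR n * (Cmod (a n) * rho ^ n) * (d / rho)) by (field; lra).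
  replace (K / rho * d * y ^ n) with (K * y ^ n * (d / rho)) by (field; lra).
  apply Rmult_le_compat_r; [apply Rle_mult_inv_pos; lra|].
  eapply Rle_trans; [|apply Hle]. apply Rmult_le_compat_r; [|nra].
  apply Rmult_le_pos; [exact P1|apply pow_le; lra].
Qed.

(** Uniformity over the disc lets this quadratic remainder serve both for the complex derivative and
    for derivatives of [f] along segments. *)
Lemma pseries_taylor (rho : R) : 0 < rho < 1 ->
  exists B, 0 <= B /\ forall z w, Cmod z <= rho -> Cmod w <= rho ->
    Cmod (h w - h z - dsum z * (w - z)) <= B * Cmod (w - z) ^ 2.
Proof.
  intros Hr. destruct (pseries_coef_sqr_le rho Hr) as [K [y [HK [Hy Hle]]]].
  exists (K / rho ^ 2 * / (1 - y)).
  assert (Hr2 : 0 < rho ^ 2) by nra.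
  split.
  { apply Rmult_le_pos; [apply Rle_mult_inv_pos; lra|]. apply Rlt_le, Rinv_0_lt_compat; lra. }
  intros z w Hz Hw.
  assert (S1 : is_series (fun n => (w ^ n * a n - z ^ n * a n
      - (w - z) * (RtoC (INR n) * z ^ pred n * a n))%C) (h w - h z - (w - z) * dsum z)%C).
  { apply (@is_series_minus C_AbsRing C_NormedModule).
    - apply (@is_series_minus C_AbsRing C_NormedModule);
        apply is_pseries_Cseries, Hh; lra.
    - apply (@is_series_scal_l C_AbsRing C_NormedModule), is_series_dsum_pred. lra. }
  rewrite (Cmult_comm (dsum z)).
  set (d := Cmod (w - z)).
  replace (K / rho ^ 2 * / (1 - y) * d ^ 2) with (K / rho ^ 2 * d ^ 2 * / (1 - y)) by ring.
  apply (Cmod_is_series_le _ (fun n => K / rho ^ 2 * d ^ 2 * y ^ n) _ _ S1).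
  { now apply is_series_geom_scal. }
  intros n.
  replace (w ^ n * a n - z ^ n * a n - (w - z) * (RtoC (INR n) * z ^ pred n * a n))%C
    with ((w ^ n - z ^ n - RtoC (INR n) * z ^ pred n * (w - z)) * a n)%C by ring.
  rewrite Cmod_mult. generalize (Cmod_ge_0 (a n)), (pow2_ge_0 d), (pos_INR n). intros P1 P2 P3.
  eapply Rle_trans; [apply Rmult_le_compat_r;
    [exact P1|apply (Cpow_taylor_le rho); auto; lra]|]. fold d.
  replace (INR n ^ 2 * rho ^ n / rho ^ 2 * d ^ 2 * Cmod (a n)) with
    (INR n ^ 2 * (Cmod (a n) * rho ^ n) * (d ^ 2 / rho ^ 2)) by (field; lra).
  replace (K / rho ^ 2 * d ^ 2 * y ^ n) with (K * y ^ n * (d ^ 2 / rho ^ 2)) by (field; lra).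
  apply Rmult_le_compat_r; [apply Rle_mult_inv_pos; lra|].
  eapply Rle_trans; [|apply Hle]. apply Rmult_le_compat_r; [|nra].
  apply Rmult_le_pos; [exact P1|apply pow_le; lra].
Qed.

Lemma is_derive_pseries (z : C) : Cmod z < 1 -> is_derive h z (dsum z).
Proof.
  intros Hz. set (rho := (1 + Cmod z) / 2).
  assert (Hr : 0 < rho < 1) by (generalize (Cmod_ge_0 z); unfold rho; lra).
  destruct (pseries_taylor rho Hr) as [B [HB HT]].
  split.
  - apply (@is_linear_scal_l C_AbsRing C_NormedModule).
  - intros x Hx. apply (@is_filter_lim_locally_unique C_AbsRing (AbsRing_NormedModule C_AbsRing)) in Hx.
    subst x. intros eps.
    (* The first bound keeps [y] in the disc of radius [rho], the second makes [B |y - z|] at most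
       [eps]; [B + 1] covers B = 0. *)
    assert (Hd : 0 < Rmin (rho - Cmod z) (eps / (B + 1))).
    { apply Rmin_glb_lt; [unfold rho; lra|]. apply Rdiv_lt_0_compat; [apply cond_pos|lra]. }
    exists (mkposreal _ Hd). intros y Hy.
    change (Cmod (y - z) < Rmin (rho - Cmod z) (eps / (B + 1))) in Hy.
    change (Cmod (h y - h z - (y - z) * dsum z) <= eps * Cmod (y - z)).
    assert (Hy1 : Cmod (y - z) < rho - Cmod z) by (eapply Rlt_le_trans; [exact Hy|apply Rmin_l]).
    assert (Hy2 : Cmod (y - z) < eps / (B + 1)) by (eapply Rlt_le_trans; [exact Hy|apply Rmin_r]).
    rewrite (Cmult_comm _ (dsum z)).
    eapply Rle_trans; [apply HT|].
    + unfold rho; lra.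
    + replace y with (z + (y - z))%C by ring. eapply Rle_trans; [apply Cmod_triangle|lra].
    + simpl pow. rewrite Rmult_1_r, <- Rmult_assoc.
      apply Rmult_le_compat_r; [apply Cmod_ge_0|].
      assert (Cmod (y - z) * (B + 1) <= eps).
      { apply Rle_trans with (eps / (B + 1) * (B + 1)); [|apply Req_le; field; lra].
        apply Rmult_le_compat_r; lra. }
      generalize (Cmod_ge_0 (y - z)). lra.
Qed.

End PowerSeries.

(** The class quantifies over all derivatives of [h] and [g], so membership of the extremal function
    requires identifying a given derivative with [dsum]. If l1 and l2 differed, the zero function
    would have the nonzero derivative l1 - l2, which the increment d/2 refutes. *)
Lemma is_derive_C_unique (f : C -> C) (z l1 l2 : C) :
  is_derive f z l1 -> is_derive f z l2 -> l1 = l2.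
Proof.
  intros H1 H2.
  assert (H : is_derive (fun _ : C => RtoC 0) z (l1 - l2)%C).
  { apply is_derive_ext with (fun y => minus (f y) (f y)).
    - intros t. change ((f t - f t)%C = RtoC 0). ring.
    - apply (@is_derive_minus C_AbsRing C_NormedModule); assumption. }
  assert (Hle : Cmod (l1 - l2) <= 0).
  { apply Rnot_lt_le. intros Hlt. destruct H as [_ H].
    assert (He : 0 < Cmod (l1 - l2) / 2) by lra.
    specialize (H z (fun P HP => HP) (mkposreal _ He)). destruct H as [d Hd].
    assert (Hd2 : 0 < d / 2) by (generalize (cond_pos d); lra).
    specialize (Hd (z + RtoC (d / 2))%C).
    assert (E : (z + RtoC (d / 2) - z)%C = RtoC (d / 2)) by ring.
    assert (Hb : Cmod (z + RtoC (d / 2) - z) < d).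
    { rewrite E, Cmod_R, Rabs_pos_eq; lra. }
    specialize (Hd Hb).
    change (Cmod (RtoC 0 - RtoC 0 - (z + RtoC (d / 2) - z) * (l1 - l2)) <=
      Cmod (l1 - l2) / 2 * Cmod (z + RtoC (d / 2) - z)) in Hd.
    rewrite E in Hd.
    replace (RtoC 0 - RtoC 0 - RtoC (d / 2) * (l1 - l2))%C with (- (RtoC (d / 2) * (l1 - l2)))%C in Hd by ring.
    rewrite Cmod_opp, Cmod_mult, Cmod_R, Rabs_pos_eq in Hd by lra. nra. }
  assert (E : (l1 - l2)%C = RtoC 0) by (apply Cmod_eq_0; generalize (Cmod_ge_0 (l1 - l2)); lra).
  replace l1 with ((l1 - l2) + l2)%C by ring. rewrite E. ring.
Qed.

(** * Functions with positive real part *)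

Definition Cexpi (t : R) : C := (cos t, sin t).

Lemma Cexpi_plus (s t : R) : Cexpi (s + t) = (Cexpi s * Cexpi t)%C.
Proof.
  unfold Cexpi, Cmult; simpl. rewrite cos_plus, sin_plus. f_equal; ring.
Qed.

Lemma Cexpi_pow (t : R) (n : nat) : (Cexpi t ^ n)%C = Cexpi (INR n * t).
Proof.
  induction n as [|n IH].
  - simpl. unfold Cexpi. now rewrite Rmult_0_l, cos_0, sin_0.
  - rewrite Cpow_S, IH, S_INR, <- Cexpi_plus. f_equal. ring.
Qed.

Lemma Cmod_Cexpi (t : R) : Cmod (Cexpi t) = 1.
Proof.
  unfold Cmod, Cexpi; simpl fst; simpl snd.
  replace (cos t ^ 2 + sin t ^ 2) with 1; [apply sqrt_1|].
  generalize (sin2_cos2 t). unfold Rsqr. lra.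
Qed.

Lemma Cexpi_PI : Cexpi PI = RtoC (-1).
Proof. unfold Cexpi, RtoC. now rewrite cos_PI, sin_PI. Qed.

Lemma Cpolar (z : C) : exists t, z = (RtoC (Cmod z) * Cexpi t)%C.
Proof.
  destruct (Req_dec (Cmod z) 0) as [H0|H0].
  - exists 0. rewrite H0, (Cmod_eq_0 z H0). ring.
  - assert (Hp : 0 < Cmod z) by (generalize (Cmod_ge_0 z); lra).
    set (r := Cmod z) in *.
    assert (E : Re z ^ 2 + Im z ^ 2 = r ^ 2) by (symmetry; apply Cmod2_alt).
    assert (Hx : -1 <= Re z / r <= 1).
    { apply Rabs_le_between. unfold Rdiv. rewrite Rabs_mult, Rabs_inv, (Rabs_pos_eq r) by lra.
      apply Rmult_le_reg_r with r; [lra|]. rewrite Rmult_assoc, Rinv_l by lra.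
      rewrite Rmult_1_l, Rmult_1_r. apply re_le_Cmod. }
    assert (Hs : sqrt (1 - (Re z / r)²) = Rabs (Im z / r)).
    { rewrite <- sqrt_Rsqr_abs. f_equal. unfold Rsqr.
      replace (1 - Re z / r * (Re z / r)) with ((r ^ 2 - Re z ^ 2) / r ^ 2) by (field; lra).
      replace (r ^ 2 - Re z ^ 2) with (Im z ^ 2) by lra. field. lra. }
    destruct (Rle_dec 0 (Im z / r)) as [Hi|Hi].
    + exists (acos (Re z / r)). unfold Cexpi. rewrite cos_acos, sin_acos, Hs, Rabs_pos_eq by assumption.
      destruct z as [x y]. unfold Cmult, RtoC, Re, Im; simpl. f_equal; field; lra.
    + exists (- acos (Re z / r)). unfold Cexpi.
      rewrite cos_neg, sin_neg, cos_acos, sin_acos, Hs, Rabs_left by lra.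
      destruct z as [x y]. unfold Cmult, RtoC, Re, Im; simpl. f_equal; field; lra.
Qed.

(** Used directly to choose a radius below 1 in the covering argument, and by contraposition to let
    r tend to 1 in inequalities. *)
Lemma left_limit_gt (F : R -> R) (s X : R) : s < 1 -> continuity_pt F 1 -> X < F 1 ->
  exists r, s < r < 1 /\ X < F r.
Proof.
  intros Hs HF Hlt.
  destruct (HF (F 1 - X) ltac:(lra)) as [d [Hd HFd]].
  set (r := 1 - Rmin d (1 - s) / 2).
  assert (Hm : 0 < Rmin d (1 - s)) by (apply Rmin_glb_lt; lra).
  generalize (Rmin_l d (1 - s)), (Rmin_r d (1 - s)); intros M1 M2.
  assert (Hr : s < r < 1) by (unfold r; lra).
  exists r; split; [exact Hr|].
  specialize (HFd r). simpl in HFd. unfold R_dist in HFd.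
  assert (H0 : Rabs (F r - F 1) < F 1 - X).
  { apply HFd. split; [split; [exact I|lra]|].
    rewrite Rabs_left by lra. unfold r. lra. }
  apply Rabs_def2 in H0. lra.
Qed.

Lemma left_limit_le (F : R -> R) (s X : R) : s < 1 -> continuity_pt F 1 ->
  (forall r, s < r < 1 -> F r <= X) -> F 1 <= X.
Proof.
  intros Hs HF H. apply Rnot_lt_le. intros Hlt.
  destruct (left_limit_gt F s X Hs HF Hlt) as [r [Hr Hr']]. specialize (H r Hr). lra.
Qed.

(** * Caratheodory's coefficient bound and Harnack's inequality *)

Section Caratheodory.

Variables (c : nat -> C) (P : C -> C).
Hypothesis HP : forall z, Cmod z < 1 -> is_pseries c z (P z).
Hypothesis Hpos : forall z, Cmod z < 1 -> 0 <= Re (P z).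

(** The real part of the k-th term of [P] at r e^(i phi); times cos(kt) it is the part, even in t,
    of that term at r e^(i(phi + t)). *)
Definition ray_coef (phi r : R) (k : nat) : R := r ^ k * Re (c k * Cexpi (INR k * phi)).

Lemma ray_coef_geom (phi r : R) : 0 < r < 1 ->
  exists K y, 0 <= y < 1 /\ forall k, Rabs (ray_coef phi r k) <= K * y ^ k.
Proof.
  intros Hr. destruct (pseries_coef_sqr_le c P HP r Hr) as [K [y [HK [Hy Hle]]]].
  exists K, y. split; [exact Hy|]. intros k. eapply Rle_trans; [|apply Hle].
  assert (Hrk : 0 <= r ^ k) by (apply pow_le; lra).
  unfold ray_coef. rewrite Rabs_mult, (Rabs_pos_eq (r ^ k)) by exact Hrk.
  assert (H1 : Rabs (Re (c k * Cexpi (INR k * phi))) <= Cmod (c k)).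
  { eapply Rle_trans; [apply re_le_Cmod|]. rewrite Cmod_mult, Cmod_Cexpi. lra. }
  generalize (pos_INR k), (Cmod_ge_0 (c k)). intros P1 P2.
  apply Rle_trans with (1 * (Cmod (c k) * r ^ k)); [nra|].
  apply Rmult_le_compat_r; [now apply Rmult_le_pos|nra].
Qed.

Lemma is_series_ray (phi r : R) : 0 <= r < 1 ->
  is_series (ray_coef phi r) (Re (P (RtoC r * Cexpi phi))).
Proof.
  intros Hr.
  assert (Hz : Cmod (RtoC r * Cexpi phi) < 1)
    by (rewrite Cmod_mult, Cmod_R, Cmod_Cexpi, Rabs_pos_eq; lra).
  generalize (proj1 (is_pseries_Cseries _ _ _) (HP _ Hz)). intros H.
  apply is_series_C in H. destruct H as [H _].
  revert H. apply is_series_Rext. intros k.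
  unfold ray_coef. rewrite Cpow_mult_l, Cexpi_pow, <- RtoC_pow.
  replace (RtoC (r ^ k) * Cexpi (INR k * phi) * c k)%C
    with (RtoC (r ^ k) * (c k * Cexpi (INR k * phi)))%C by ring.
  apply re_scal_l.
Qed.

(* The mean of [Re P] over the two conjugate directions [phi + t] and [phi - t]
   is an even function of [t], that is, a cosine series. *)
Lemma ray_cosine_series_ge0 (phi r : R) : 0 < r < 1 ->
  forall t l : R, is_series (fun k => ray_coef phi r k * cos (INR k * t)) l -> 0 <= l.
Proof.
  intros Hr t l Hl.
  assert (H1 := is_series_ray (phi + t) r ltac:(lra)).
  assert (H2 := is_series_ray (phi - t) r ltac:(lra)).
  assert (H3 : is_series (fun k => / 2 * (ray_coef (phi + t) r k + ray_coef (phi - t) r k))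
    (/ 2 * (Re (P (RtoC r * Cexpi (phi + t))) + Re (P (RtoC r * Cexpi (phi - t)))))).
  { apply is_series_Rscal. exact (is_series_plus _ _ _ _ H1 H2). }
  assert (H4 : is_series (fun k => ray_coef phi r k * cos (INR k * t))
    (/ 2 * (Re (P (RtoC r * Cexpi (phi + t))) + Re (P (RtoC r * Cexpi (phi - t)))))).
  { revert H3. apply is_series_Rext. intros k. unfold ray_coef.
    rewrite (Rmult_plus_distr_l _ phi t), (Rmult_minus_distr_l _ phi t).
    unfold Cexpi. rewrite !re_mult; simpl. rewrite cos_plus, cos_minus, sin_plus, sin_minus. field. }
  rewrite <- (is_series_unique _ _ Hl), (is_series_unique _ _ H4).
  assert (forall s, 0 <= Re (P (RtoC r * Cexpi s))).
  { intros s. apply Hpos. rewrite Cmod_mult, Cmod_R, Cmod_Cexpi, Rabs_pos_eq; lra. }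
  generalize (H (phi + t)), (H (phi - t)). lra.
Qed.

Lemma ray_coef_0 (phi r : R) : ray_coef phi r 0 = Re (c 0%nat).
Proof.
  unfold ray_coef. simpl INR. rewrite Rmult_0_l. unfold Cexpi. rewrite cos_0, sin_0, re_mult; simpl. ring.
Qed.

(** In a direction [phi] with c_n e^(i n phi) = -|c_n|, the bound 2 A_0 + A_n >= 0 reads r^n |c_n|
    <= 2 Re c_0; then r tends to 1. *)
Lemma caratheodory_coef (n : nat) : (1 <= n)%nat -> Cmod (c n) <= 2 * Re (c 0%nat).
Proof.
  intros Hn.
  destruct (Cpolar (c n)) as [s Hs].
  assert (Hn0 : 0 < INR n) by (apply lt_0_INR; lia).
  set (phi := (PI - s) / INR n).
  replace (Cmod (c n)) with (1 ^ n * Cmod (c n)) by (rewrite pow1; ring).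
  apply (left_limit_le (fun r => r ^ n * Cmod (c n)) 0).
  - lra.
  - apply continuity_pt_mult; [apply derivable_continuous_pt, derivable_pt_pow|].
    apply continuity_pt_const. now intros ? ?.
  - intros r Hr.
    destruct (ray_coef_geom phi r Hr) as [K [y [Hy HA]]].
    generalize (cosine_series_coef_ge _ K y Hy HA (ray_cosine_series_ge0 phi r Hr) n Hn).
    rewrite ray_coef_0. unfold ray_coef.
    replace (c n * Cexpi (INR n * phi))%C with (RtoC (- Cmod (c n))).
    + simpl. lra.
    + rewrite Hs at 2. rewrite <- Cmult_assoc, <- Cexpi_plus.
      replace (s + INR n * phi) with PI by (unfold phi; field; lra).
      rewrite Cexpi_PI, <- RtoC_mult. f_equal. ring.
Qed.

(** The point of modulus s is seen from a circle of radius r > s with ratio q = s/r; then r tends to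
    1. *)
Lemma caratheodory_harnack (z : C) : Cmod z < 1 ->
  Re (c 0%nat) * ((1 - Cmod z) / (1 + Cmod z)) <= Re (P z).
Proof.
  intros Hz. destruct (Cpolar z) as [phi Hphi].
  set (s := Cmod z) in *. assert (Hs : 0 <= s) by apply Cmod_ge_0.
  apply Rle_trans with (Re (c 0%nat) * ((1 - s / 1) / (1 + s / 1))).
  { right. f_equal. field. lra. }
  apply (left_limit_le (fun r => Re (c 0%nat) * ((1 - s / r) / (1 + s / r))) s).
  - exact Hz.
  - apply continuity_pt_filterlim.
    refine (ex_derive_continuous (fun r => Re (c 0%nat) * ((1 - s / r) / (1 + s / r))) 1 _).
    auto_derive. repeat split; try lra.
  - intros r Hr.
    destruct (ray_coef_geom phi r ltac:(lra)) as [K [y [Hy HA]]].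
    rewrite <- (ray_coef_0 phi r).
    apply (cosine_series_harnack _ K y Hy HA (ray_cosine_series_ge0 phi r ltac:(lra))).
    + split; [apply Rle_mult_inv_pos; lra|].
      apply Rmult_lt_reg_r with r; [lra|]. unfold Rdiv. rewrite Rmult_assoc, Rinv_l; lra.
    + rewrite Hphi. generalize (is_series_ray phi s ltac:(lra)).
      apply is_series_Rext. intros k. unfold ray_coef, Rdiv.
      rewrite Rpow_mult_distr, pow_inv. field. apply pow_nonzero; lra.
Qed.

End Caratheodory.

Lemma is_pseries_const (w z : C) :
  is_pseries (fun k => match k with O => w | _ => RtoC 0 end) z w.
Proof.
  apply is_pseries_Cseries. unfold is_series.
  apply filterlim_ext with (fun _ : nat => w); [|apply filterlim_const].
  induction x as [|n IH].
  - rewrite sum_O. simpl. ring.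
  - rewrite sum_Sn, <- IH. change (w = (w + z ^ S n * 0)%C). ring.
Qed.

(** * Logarithmic series and the equation for the radius *)

(** Scaling by t turns the remainder at [c] into an increment over [0,1] whatever the sign of [c];
    its derivative is -c/(1 - ct) plus a finite geometric sum. *)
Lemma derivable_pt_lim_log_remainder (c t : R) (N : nat) : c * t < 1 ->
  derivable_pt_lim
    (fun t => ln (1 - c * t) + sum_f_R0 (fun k => (c * t) ^ S k / INR (S k)) N) t
    (- c * (c * t) ^ S N / (1 - c * t)).
Proof.
  intros Ht.
  assert (Hlin : derivable_pt_lim (fun t => c * t) t c).
  { apply is_derive_Reals. auto_derive; [exact I|ring]. }
  assert (Hmon : forall k, derivable_pt_lim (fun t => (c * t) ^ S k / INR (S k)) t (c * (c * t) ^ k)).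
  { intros k. assert (Hk : INR (S k) <> 0) by (apply not_0_INR; lia).
    replace (c * (c * t) ^ k) with (INR (S k) * (c * t) ^ pred (S k) * c * / INR (S k))
      by (simpl pred; field; exact Hk).
    apply derivable_pt_lim_scal_right.
    apply (derivable_pt_lim_comp (fun t => c * t) (fun y => y ^ S k) t c); [exact Hlin|].
    apply derivable_pt_lim_pow. }
  assert (Hsum : derivable_pt_lim (fun t => sum_f_R0 (fun k => (c * t) ^ S k / INR (S k)) N) t
    (sum_f_R0 (fun k => c * (c * t) ^ k) N)).
  { induction N as [|N IH]; [exact (Hmon 0%nat)|].
    exact (derivable_pt_lim_plus _ _ _ _ _ IH (Hmon (S N))). }
  replace (- c * (c * t) ^ S N / (1 - c * t)) with
    (- c / (1 - c * t) + sum_f_R0 (fun k => c * (c * t) ^ k) N).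
  - apply (derivable_pt_lim_plus (fun t => ln (1 - c * t))); [|exact Hsum].
    apply is_derive_Reals. auto_derive; [lra|]. field. lra.
  - clear Hsum. induction N as [|N IH]; [simpl; field; lra|].
    rewrite tech5, <- Rplus_assoc, IH. simpl. field. lra.
Qed.

(** On [0,1] one has 1/(1 - ct) <= M, so the derivative of the remainder is dominated by that of
    [W], and the mean value theorem for [D + W] and [D - W] compares increments. The range includes
    c = -1, which the equation for the radius requires. *)
Lemma log_remainder_le (c : R) (N : nat) : -1 <= c < 1 ->
  Rabs (sum_f_R0 (fun k => c ^ S k / INR (S k)) N + ln (1 - c)) <=
    / (1 - Rmax c 0) * / INR (S (S N)).
Proof.
  intros Hc. set (M := / (1 - Rmax c 0)).
  assert (Hm : Rmax c 0 < 1) by (apply Rmax_lub_lt; lra).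
  assert (HM : 0 < M) by (apply Rinv_0_lt_compat; lra).
  assert (HN : 0 < INR (S (S N))) by (apply lt_0_INR; lia).
  set (D := fun t => ln (1 - c * t) + sum_f_R0 (fun k => (c * t) ^ S k / INR (S k)) N).
  set (W := fun t => M / INR (S (S N)) * t ^ S (S N)).
  assert (HD1 : D 1 = sum_f_R0 (fun k => c ^ S k / INR (S k)) N + ln (1 - c)).
  { unfold D. rewrite Rmult_1_r. ring. }
  assert (HD0 : D 0 = 0).
  { unfold D. rewrite Rmult_0_r, Rminus_0_r, ln_1, Rplus_0_l.
    rewrite (sum_eq _ (fun _ => 0)); [now rewrite sum_cte, Rmult_0_l|].
    intros k _. simpl pow. unfold Rdiv. ring. }
  assert (HW1 : W 1 = M * / INR (S (S N))) by (unfold W; rewrite pow1; field; lra).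
  assert (HW0 : W 0 = 0) by (unfold W; simpl pow; ring).
  assert (dW : forall t, derivable_pt_lim W t (M * t ^ S N)).
  { intros t. unfold W. replace (M * t ^ S N) with
      (M / INR (S (S N)) * (INR (S (S N)) * t ^ pred (S (S N)))) by (simpl pred; field; lra).
    apply derivable_pt_lim_scal, derivable_pt_lim_pow. }
  assert (Hct : forall t, 0 <= t <= 1 -> c * t <= Rmax c 0).
  { intros t Ht. destruct (Rle_dec 0 c).
    - rewrite Rmax_left by lra. nra.
    - rewrite Rmax_right by lra. nra. }
  assert (dD : forall t, 0 <= t <= 1 -> derivable_pt_lim D t (- c * (c * t) ^ S N / (1 - c * t))).
  { intros t Ht. apply derivable_pt_lim_log_remainder. specialize (Hct t Ht). lra. }
  assert (bD : forall t, 0 <= t <= 1 ->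
    Rabs (- c * (c * t) ^ S N / (1 - c * t)) <= M * t ^ S N).
  { intros t Ht. specialize (Hct t Ht).
    assert (Hc1 : Rabs c <= 1) by (apply Rabs_le; lra).
    unfold Rdiv. rewrite !Rabs_mult, Rabs_Ropp, <- RPow_abs, Rabs_mult, Rabs_inv.
    rewrite (Rabs_pos_eq t), (Rabs_pos_eq (1 - c * t)) by lra.
    assert (H1 : / (1 - c * t) <= M) by (apply Rinv_le_contravar; lra).
    assert (H2 : (Rabs c * t) ^ S N <= t ^ S N).
    { apply pow_incr. generalize (Rabs_pos c); nra. }
    assert (H3 : 0 <= (Rabs c * t) ^ S N).
    { apply pow_le, Rmult_le_pos; [apply Rabs_pos|lra]. }
    assert (H4 : 0 < / (1 - c * t)) by (apply Rinv_0_lt_compat; lra).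
    generalize (Rabs_pos c); intros H5.
    rewrite (Rmult_comm M). apply Rmult_le_compat; [|lra| |exact H1].
    - now apply Rmult_le_pos.
    - nra. }
  rewrite <- HD1, <- HW1. apply Rabs_le. split.
  - destruct (MVT_cor2 (fun t => D t + W t)
      (fun t => - c * (c * t) ^ S N / (1 - c * t) + M * t ^ S N) 0 1 Rlt_0_1) as [x [Hx Hx']].
    { intros t Ht. apply derivable_pt_lim_plus; auto. }
    assert (Hb := bD x ltac:(lra)). apply Rabs_le_between in Hb. lra.
  - destruct (MVT_cor2 (fun t => D t - W t)
      (fun t => - c * (c * t) ^ S N / (1 - c * t) - M * t ^ S N) 0 1 Rlt_0_1) as [x [Hx Hx']].
    { intros t Ht. apply derivable_pt_lim_minus; auto. }
    assert (Hb := bD x ltac:(lra)). apply Rabs_le_between in Hb. lra.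
Qed.

Lemma is_series_log (c : R) : -1 <= c < 1 ->
  is_series (fun k => c ^ S k / INR (S k)) (- ln (1 - c)).
Proof.
  intros Hc.
  change (is_lim_seq (sum_n (fun k => c ^ S k / INR (S k))) (- ln (1 - c))).
  assert (H0 : is_lim_seq (fun N => / (1 - Rmax c 0) * / INR (S (S N))) 0).
  { replace (Finite 0) with (Rbar_mult (/ (1 - Rmax c 0)) 0) by (simpl; f_equal; ring).
    apply is_lim_seq_scal_l.
    apply (is_lim_seq_incr_1 (fun n => / INR (S n)) 0).
    apply (is_lim_seq_incr_1 (fun n => / INR n) 0).
    apply (is_lim_seq_inv INR p_infty); [apply is_lim_seq_INR|discriminate]. }
  assert (H1 : is_lim_seq (fun N => sum_f_R0 (fun k => c ^ S k / INR (S k)) N + ln (1 - c)) 0).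
  { apply is_lim_seq_abs_0.
    apply (is_lim_seq_le_le (fun _ => 0) _ (fun N => / (1 - Rmax c 0) * / INR (S (S N)))); auto.
    - intros N; split; [apply Rabs_pos|now apply log_remainder_le].
    - apply is_lim_seq_const. }
  apply is_lim_seq_ext with (fun N => sum_f_R0 (fun k => c ^ S k / INR (S k)) N + ln (1 - c) + - ln (1 - c)).
  - intros n. rewrite sum_n_Reals. ring.
  - replace (Finite (- ln (1 - c))) with (Finite (0 + - ln (1 - c))) by (f_equal; ring).
    apply is_lim_seq_plus'; [exact H1|apply is_lim_seq_const].
Qed.

Lemma is_series_log_tail (c : R) : -1 <= c < 1 ->
  is_series (fun n => c ^ (n + 2) / INR (n + 2)) (- ln (1 - c) - c).
Proof.
  intros Hc. generalize (is_series_incr_1 (fun k => c ^ S k / INR (S k)) (- ln (1 - c) - c)).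
  intros H. eapply is_series_Rext; [|apply H].
  - intros n. now replace (n + 2)%nat with (S (S n)) by lia.
  - generalize (is_series_log c Hc). intros H1.
    match goal with |- is_series _ ?l => replace l with (- ln (1 - c)) end; auto.
    change (- ln (1 - c) = - ln (1 - c) - c + c ^ 1 / INR 1). simpl. field.
Qed.

(* On [[0,1)] this is the left-hand side of the equation for [r_f]; on the whole of
   [(-1,1)] it is the extremal function, and [- extremal alpha (-1)] is the
   right-hand side of that equation. *)
Definition extremal (alpha x : R) : R := x + 2 * (1 - alpha) * (- ln (1 - x) - x).

(** At x = -t this derivative is the Harnack lower bound at modulus t, which is why the growth
    estimate is expressed through [extremal]. *)
Lemma extremal_derivable (alpha x : R) : x < 1 ->
  derivable_pt_lim (extremal alpha) x (alpha + (1 - alpha) * ((1 + x) / (1 - x))).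
Proof.
  intros Hx. apply is_derive_Reals. unfold extremal. auto_derive; [lra|]. field. lra.
Qed.

Lemma extremal_continuous (alpha x : R) : x < 1 -> continuity_pt (extremal alpha) x.
Proof.
  intros Hx. apply derivable_continuous_pt.
  eexists. now apply extremal_derivable.
Qed.

Lemma extremal_increasing (alpha x y : R) : 0 <= alpha < 1 -> -1 <= x -> x < y -> y < 1 ->
  extremal alpha x < extremal alpha y.
Proof.
  intros Ha Hx Hxy Hy.
  destruct (MVT_cor2 (extremal alpha) (fun x => alpha + (1 - alpha) * ((1 + x) / (1 - x))) x y Hxy)
    as [z [Hz Hz']].
  { intros t Ht. apply extremal_derivable. lra. }
  assert (0 < (1 + z) / (1 - z)) by (apply Rdiv_lt_0_compat; lra).
  assert (0 < alpha + (1 - alpha) * ((1 + z) / (1 - z))) by nra.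
  nra.
Qed.

Lemma extremal_0 (alpha : R) : extremal alpha 0 = 0.
Proof. unfold extremal. replace (1 - 0) with 1 by ring. rewrite ln_1. ring. Qed.

Lemma rf_eq_extremal (alpha r : R) : 0 <= r < 1 ->
  rf_eq alpha r <-> extremal alpha r = - extremal alpha (-1).
Proof.
  intros Hr. unfold rf_eq.
  rewrite (is_series_unique _ _ (is_series_log_tail r ltac:(lra))).
  (* The alternating series has exponent one less than its denominator, hence is minus the
     logarithmic tail at -1. *)
  assert (H : is_series (fun n => (-1) ^ (n + 1) / INR (n + 2)) (-1 * (- ln (1 - -1) - -1))).
  { apply is_series_Rext with (fun n => -1 * ((-1) ^ (n + 2) / INR (n + 2))).
    - intros n. rewrite (pow_add _ n 2), (pow_add _ n 1). simpl pow. unfold Rdiv. ring.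
    - apply is_series_Rscal, is_series_log_tail. lra. }
  rewrite (is_series_unique _ _ H). unfold extremal.
  replace (1 + 2 * (1 - alpha) * (-1 * (- ln (1 - -1) - -1))) with
    (- (-1 + 2 * (1 - alpha) * (- ln (1 - -1) - -1))) by ring. tauto.
Qed.

(** The right-hand side [d] = 1 - 2(1 - alpha)(1 - ln 2) lies in (0,1) and serves itself as right
    endpoint: -ln(1 - d) > d gives [extremal alpha d > d], away from the singularity at 1. *)
Lemma rf_exists_unique (alpha : R) : 0 <= alpha < 1 ->
  exists! r : R, 0 < r < 1 /\ rf_eq alpha r.
Proof.
  intros Ha.
  assert (Hneg : extremal alpha (-1) < 0).
  { rewrite <- (extremal_0 alpha). apply extremal_increasing; lra. }
  set (d := - extremal alpha (-1)).
  assert (Hln : ln 2 < 1).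
  { apply exp_lt_inv. rewrite exp_ln by lra. apply (exp_ineq1 1). lra. }
  assert (Hd0 : 0 < d) by (unfold d; lra).
  assert (Hd1 : d < 1).
  { unfold d, extremal. replace (1 - -1) with 2 by ring. nra. }
  assert (Hd : d < extremal alpha d).
  { unfold extremal. assert (ln (1 - d) < - d).
    { apply exp_lt_inv. rewrite exp_ln by lra.
      apply (exp_ineq1 (- d)). unfold d; lra. }
    nra. }
  destruct (IVT_interv (fun x => extremal alpha x - d) 0 d) as [r [Hr Hr0]].
  - intros x Hx. apply continuity_pt_minus; [apply extremal_continuous; lra|].
    apply continuity_pt_const. now intros ? ?.
  - lra.
  - rewrite extremal_0. lra.
  - lra.
  - assert (r <> 0) by (intros ->; rewrite extremal_0 in Hr0; lra).
    exists r. split.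
    + split; [lra|]. apply rf_eq_extremal; [lra|]. fold d. lra.
    + intros x [Hx Hx']. apply rf_eq_extremal in Hx'; [|lra]. fold d in Hx'.
      destruct (Rtotal_order r x) as [H1|[H1|H1]]; [|exact H1|].
      * generalize (extremal_increasing alpha r x Ha). lra.
      * generalize (extremal_increasing alpha x r Ha). lra.
Qed.

(** * Strongly monotone maps of the plane *)

Definition Cdot (z w : C) : R := Re z * Re w + Im z * Im w.

Lemma Cdot_Re (z w : C) : Cdot z w = Re (Cconj z * w).
Proof. unfold Cdot. rewrite re_mult, re_conj, im_conj. ring. Qed.

Lemma Cdot_le (z w : C) : Rabs (Cdot z w) <= Cmod z * Cmod w.
Proof.
  rewrite Cdot_Re. eapply Rle_trans; [apply re_le_Cmod|].
  rewrite Cmod_mult, Cmod_conj. lra.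
Qed.

Lemma Cdot_plus_r (z w1 w2 : C) : Cdot z (w1 + w2) = Cdot z w1 + Cdot z w2.
Proof. unfold Cdot, Re, Im; simpl. ring. Qed.

Lemma Cdot_minus_r (z w1 w2 : C) : Cdot z (w1 - w2) = Cdot z w1 - Cdot z w2.
Proof. unfold Cdot, Re, Im; simpl. ring. Qed.

Lemma Cdot_scal_r (z w : C) (t : R) : Cdot z (RtoC t * w) = t * Cdot z w.
Proof. unfold Cdot, Re, Im; simpl. ring. Qed.

Lemma Cdot_scal_l (z w : C) (t : R) : Cdot (RtoC t * z) w = t * Cdot z w.
Proof. unfold Cdot, Re, Im; simpl. ring. Qed.

Lemma Cmod_minus_sqr (z w : C) :
  Cmod (z - w) ^ 2 = Cmod z ^ 2 - 2 * Cdot z w + Cmod w ^ 2.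
Proof. rewrite !Cmod2_alt. unfold Cdot, Re, Im; simpl. ring. Qed.

Lemma Cmod_le_sub (z w : C) : Cmod z <= Cmod w + Cmod (z - w).
Proof.
  replace z with (w + (z - w))%C at 1 by ring. apply Cmod_triangle.
Qed.

Lemma is_lim_seq_Cmod_series (u : nat -> C) (l : C) :
  is_series u l -> is_lim_seq (fun n => Cmod (sum_n u n - l)) 0.
Proof.
  intros H. apply is_lim_seq_spec. intros eps.
  assert (He : 0 < eps / 2) by (generalize (cond_pos eps); lra).
  generalize (proj1 (filterlim_locally _ _) H (mkposreal _ He)). apply filter_imp.
  (* Balls of [C] are squares, so passing to the modulus costs a factor [sqrt 2], covered by the
     halved [eps]. *)
  intros n Hn. apply C_NormedModule_mixin_compat2 in Hn. simpl in Hn.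
  change (Cmod (sum_n u n - l) < sqrt 2 * (eps / 2)) in Hn.
  rewrite Rminus_0_r, Rabs_pos_eq by apply Cmod_ge_0.
  assert (Hs : sqrt 2 <= 2).
  { rewrite <- (sqrt_square 2) at 2 by lra. apply sqrt_le_1; lra. }
  nra.
Qed.

Lemma contraction_fixpoint (T : C -> C) (rho q : R) : 0 <= rho -> 0 <= q < 1 ->
  (forall z, Cmod z <= rho -> Cmod (T z) <= rho) ->
  (forall z w, Cmod z <= rho -> Cmod w <= rho -> Cmod (T w - T z) <= q * Cmod (w - z)) ->
  exists z, Cmod z <= rho /\ T z = z.
Proof.
  intros Hrho Hq Hself Hcontr.
  set (x := fix x (n : nat) : C := match n with O => RtoC 0 | S n => T (x n) end).
  assert (Hx : forall n, Cmod (x n) <= rho).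
  { induction n as [|n IH]; [simpl; rewrite Cmod_0; lra|]. now apply Hself. }
  (* Completeness enters through summability of the increments; their partial sums are the iterates
     since x 0 = 0. *)
  set (u := fun n => (x (S n) - x n)%C).
  assert (Hu : forall n, Cmod (u n) <= Cmod (u 0%nat) * q ^ n).
  { induction n as [|n IH]; [simpl; lra|].
    eapply Rle_trans; [apply (Hcontr (x n) (x (S n))); apply Hx|].
    fold (u n). simpl pow. nra. }
  destruct (ex_series_C_le u _ Hu) as [l Hl].
  { eexists. now apply is_series_geom_scal. }
  assert (Hsum : forall n, sum_n u n = x (S n)).
  { induction n as [|n IH].
    - rewrite sum_O. unfold u. simpl. ring.
    - rewrite sum_Sn, IH. change ((x (S n) + (x (S (S n)) - x (S n)))%C = x (S (S n))). ring. }
  assert (Hlim : is_lim_seq (fun n => Cmod (x (S n) - l)) 0).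
  { apply is_lim_seq_ext with (fun n => Cmod (sum_n u n - l)).
    - intros n. now rewrite Hsum.
    - now apply is_lim_seq_Cmod_series. }
  assert (Hl1 : Cmod l <= rho).
  { assert (Hlim1 : is_lim_seq (fun n => rho + Cmod (x (S n) - l)) (rho + 0)).
    { apply is_lim_seq_plus'; [apply is_lim_seq_const|exact Hlim]. }
    rewrite Rplus_0_r in Hlim1.
    refine (is_lim_seq_le (fun _ => Cmod l) _ (Cmod l) rho _ (is_lim_seq_const _) Hlim1).
    intros n. eapply Rle_trans; [apply (Cmod_le_sub l (x (S n)))|].
    rewrite <- (Cmod_opp (l - x (S n))).
    replace (- (l - x (S n)))%C with (x (S n) - l)%C by ring.
    generalize (Hx (S n)); lra. }
  exists l. split; [exact Hl1|].
  assert (Hz : Cmod (T l - l) <= 0).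
  { assert (Hlim2 : is_lim_seq (fun n => Cmod (x (S (S n)) - l)) 0)
      by now apply (is_lim_seq_incr_1 (fun n => Cmod (x (S n) - l)) 0).
    assert (Hlim3 : is_lim_seq (fun n => q * Cmod (x (S n) - l) + Cmod (x (S (S n)) - l)) (q * 0 + 0)).
    { apply is_lim_seq_plus'; [|exact Hlim2].
      apply is_lim_seq_mult'; [apply is_lim_seq_const|exact Hlim]. }
    rewrite Rmult_0_r, Rplus_0_r in Hlim3.
    refine (is_lim_seq_le (fun _ => Cmod (T l - l)) _ (Cmod (T l - l)) 0 _ (is_lim_seq_const _) Hlim3).
    intros n.
    replace (T l - l)%C with (- (T (x (S n)) - T l) + (x (S (S n)) - l))%C by (simpl; ring).
    eapply Rle_trans; [apply Cmod_triangle|]. rewrite Cmod_opp.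
    apply Rplus_le_compat_r, Hcontr; auto. }
  assert (E : (T l - l)%C = RtoC 0) by (apply Cmod_eq_0; generalize (Cmod_ge_0 (T l - l)); lra).
  replace (T l) with ((T l - l) + l)%C by ring. rewrite E. ring.
Qed.

(* For small [t], the map [z - t (f z - w)] is a contraction of the closed disc of
   radius [rho]: it moves points of modulus at most [rho'] by at most [rho - rho'], and
   pulls the remaining ones inwards by [Hout]. *)
Lemma monotone_covers (f : C -> C) (rho' rho m B kap : R) (w : C) :
  0 < rho' < rho -> 0 < m -> 0 <= B -> 0 < kap ->
  (forall z z', Cmod z <= rho -> Cmod z' <= rho -> Cmod (f z' - f z) <= B * Cmod (z' - z)) ->
  (forall z z', Cmod z <= rho -> Cmod z' <= rho ->
     m * Cmod (z' - z) ^ 2 <= Cdot (z' - z) (f z' - f z)) ->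
  (forall z, rho' <= Cmod z <= rho -> kap <= Cdot z (f z - w)) ->
  exists z, Cmod z <= rho /\ f z = w.
Proof.
  intros Hrho Hm HB Hkap Hlip Hmon Hout.
  set (N := B * rho + Cmod (f (RtoC 0) - w) + 1).
  assert (HN : 1 <= N).
  { unfold N. generalize (Cmod_ge_0 (f (RtoC 0) - w)). nra. }
  assert (HfN : forall z, Cmod z <= rho -> Cmod (f z - w) <= N).
  { intros z Hz. replace (f z - w)%C with ((f z - f (RtoC 0)) + (f (RtoC 0) - w))%C by ring.
    eapply Rle_trans; [apply Cmod_triangle|].
    assert (H0 : Cmod (RtoC 0) <= rho) by (rewrite Cmod_0; lra).
    generalize (Hlip (RtoC 0) z H0 Hz). replace (z - RtoC 0)%C with z by ring.
    unfold N. nra. }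
  (* In order, the four bounds make t^2 |f z' - f z|^2 at most t m |z' - z|^2, put the ratio 1 -
     tm/2 in [0,1), limit the displacement of inner points to rho - rho', and let the inward pull 2
     t kap on outer points outweigh t^2 N^2. *)
  set (t := Rmin (Rmin (m / (B + 1) ^ 2) (/ m)) (Rmin ((rho - rho') / N) (2 * kap / N ^ 2))).
  assert (HB2 : 0 < (B + 1) ^ 2) by nra.
  assert (HN2 : 0 < N ^ 2) by nra.
  assert (Ht : 0 < t).
  { repeat apply Rmin_glb_lt; try (apply Rdiv_lt_0_compat; lra). now apply Rinv_0_lt_compat. }
  assert (Ht1 : t <= m / (B + 1) ^ 2) by (eapply Rle_trans; [apply Rmin_l|apply Rmin_l]).
  assert (Ht2 : t <= / m) by (eapply Rle_trans; [apply Rmin_l|apply Rmin_r]).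
  assert (Ht3 : t <= (rho - rho') / N) by (eapply Rle_trans; [apply Rmin_r|apply Rmin_l]).
  assert (Ht4 : t <= 2 * kap / N ^ 2) by (eapply Rle_trans; [apply Rmin_r|apply Rmin_r]).
  clearbody t.
  assert (Hdiv : forall x y, 0 < y -> t <= x / y -> t * y <= x).
  { intros x y Hy Hxy. apply Rmult_le_compat_r with (r := y) in Hxy; [|lra].
    unfold Rdiv in Hxy. rewrite Rmult_assoc, Rinv_l in Hxy by lra. lra. }
  apply Hdiv in Ht1; [|exact HB2]. apply Hdiv in Ht3; [|lra]. apply Hdiv in Ht4; [|exact HN2].
  assert (Ht2' : t * m <= 1).
  { apply Hdiv; [exact Hm|]. unfold Rdiv. lra. }
  destruct (contraction_fixpoint (fun z => (z - RtoC t * (f z - w))%C) rho (1 - t * m / 2))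
    as [z [Hz HTz]].
  - lra.
  - nra.
  - intros z Hz. generalize (HfN z Hz), (Cmod_ge_0 (f z - w)), (Cmod_ge_0 z). intros P1 P2 P3.
    destruct (Rle_dec rho' (Cmod z)) as [Hr|Hr].
    + apply Rsqr_incr_0; [|apply Cmod_ge_0|lra]. rewrite !Rsqr_pow2.
      rewrite Cmod_minus_sqr, Cdot_scal_r, Cmod_mult, Cmod_R, (Rabs_pos_eq t) by lra.
      specialize (Hout z (conj Hr Hz)).
      assert (Cmod z ^ 2 <= rho ^ 2) by (apply pow_incr; lra).
      assert (Cmod (f z - w) ^ 2 <= N ^ 2) by (apply pow_incr; lra).
      assert (t * Cmod (f z - w) ^ 2 <= 2 * kap) by nra.
      assert (t * (t * Cmod (f z - w) ^ 2) <= t * (2 * Cdot z (f z - w))).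
      { apply Rmult_le_compat_l; lra. }
      nra.
    + eapply Rle_trans; [apply Cmod_triangle|].
      rewrite Cmod_opp, Cmod_mult, Cmod_R, (Rabs_pos_eq t) by lra. nra.
  - intros z z' Hz Hz'.
    apply Rsqr_incr_0; [|apply Cmod_ge_0|apply Rmult_le_pos; [nra|apply Cmod_ge_0]].
    rewrite !Rsqr_pow2.
    replace (z' - RtoC t * (f z' - w) - (z - RtoC t * (f z - w)))%C
      with ((z' - z) - RtoC t * (f z' - f z))%C by ring.
    rewrite Cmod_minus_sqr, Cdot_scal_r, Cmod_mult, Cmod_R, (Rabs_pos_eq t) by lra.
    specialize (Hlip z z' Hz Hz'). specialize (Hmon z z' Hz Hz').
    set (D := Cmod (z' - z)) in *. set (F := Cmod (f z' - f z)) in *.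
    assert (HD : 0 <= D) by apply Cmod_ge_0. assert (HF : 0 <= F) by apply Cmod_ge_0.
    assert (HF2 : F ^ 2 <= (B + 1) ^ 2 * D ^ 2).
    { rewrite <- Rpow_mult_distr. apply pow_incr. nra. }
    assert (HD2 : 0 <= D ^ 2) by apply pow2_ge_0.
    assert (H1 : t * F ^ 2 <= m * D ^ 2).
    { apply Rle_trans with (t * ((B + 1) ^ 2 * D ^ 2)); [nra|].
      rewrite <- Rmult_assoc. now apply Rmult_le_compat_r. }
    assert (H2 : t * (t * F ^ 2) <= t * (m * D ^ 2)) by (apply Rmult_le_compat_l; lra).
    assert (H3 : t * (m * D ^ 2) <= t * Cdot (z' - z) (f z' - f z))
      by (apply Rmult_le_compat_l; lra).
    rewrite !Rpow_mult_distr.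
    (* The squared distance shrinks by 1 - 2tm + tm = 1 - tm, and 1 - tm <= (1 - tm/2)^2. *)
    assert (H4 : (1 - t * m) * D ^ 2 <= (1 - t * m / 2) ^ 2 * D ^ 2)
      by (apply Rmult_le_compat_r; nra).
    nra.
  - exists z. split; [exact Hz|].
    assert (E : (RtoC t * (f z - w))%C = RtoC 0).
    { replace (RtoC t * (f z - w))%C with (z - (z - RtoC t * (f z - w)))%C by ring.
      rewrite HTz. ring. }
    assert (E2 : (f z - w)%C = RtoC 0).
    { apply Cmod_eq_0. apply (f_equal Cmod) in E.
      rewrite Cmod_mult, Cmod_R, Cmod_0, Rabs_pos_eq in E by lra.
      apply Rmult_integral in E. destruct E; [lra|assumption]. }
    replace (f z) with ((f z - w) + w)%C by ring. rewrite E2. ring.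
Qed.

(** * The class of harmonic functions *)

Lemma derivable_pt_lim_quadratic (phi : R -> R) (t l B d : R) : 0 < d -> 0 <= B ->
  (forall s, Rabs s < d -> Rabs (phi (t + s) - phi t - l * s) <= B * s ^ 2) ->
  derivable_pt_lim phi t l.
Proof.
  intros Hd HB H eps Heps.
  assert (Hm : 0 < Rmin d (eps / (B + 1))).
  { apply Rmin_glb_lt; [exact Hd|]. apply Rdiv_lt_0_compat; lra. }
  exists (mkposreal _ Hm). intros s Hs0 Hs. simpl in Hs.
  assert (Hs1 : Rabs s < d) by (eapply Rlt_le_trans; [exact Hs|apply Rmin_l]).
  assert (Hs2 : Rabs s < eps / (B + 1)) by (eapply Rlt_le_trans; [exact Hs|apply Rmin_r]).
  specialize (H s Hs1).
  assert (Hp : 0 < Rabs s) by now apply Rabs_pos_lt.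
  replace ((phi (t + s) - phi t) / s - l) with ((phi (t + s) - phi t - l * s) / s) by now field.
  unfold Rdiv. rewrite Rabs_mult, Rabs_inv.
  apply Rmult_lt_reg_r with (Rabs s); [exact Hp|]. rewrite Rmult_assoc, Rinv_l, Rmult_1_r by lra.
  eapply Rle_lt_trans; [exact H|]. rewrite <- pow2_abs.
  assert (Rabs s * (B + 1) < eps).
  { apply Rmult_lt_compat_r with (r := B + 1) in Hs2; [|lra].
    unfold Rdiv in Hs2. rewrite Rmult_assoc, Rinv_l in Hs2; lra. }
  nra.
Qed.

Section ClassPH0.

Variables (alpha : R) (h g : C -> C) (a b : nat -> C).
Hypothesis Halpha : 0 <= alpha < 1.
Hypothesis HPH : in_PH0 alpha h g a b.

Let f : C -> C := harm h g.

Lemma PH0_pseries_h (z : C) : Cmod z < 1 -> is_pseries a z (h z).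
Proof. destruct HPH as [[_ [_ [_ [_ H]]]] _]. intros Hz. apply (H z Hz). Qed.

Lemma PH0_pseries_g (z : C) : Cmod z < 1 -> is_pseries b z (g z).
Proof. destruct HPH as [[_ [_ [_ [_ H]]]] _]. intros Hz. apply (H z Hz). Qed.

Lemma PH0_dsum (z : C) : Cmod z < 1 -> Cmod (dsum b z) < Re (dsum a z) - alpha.
Proof.
  intros Hz. destruct HPH as [_ H]. apply Rgt_lt, (H z Hz).
  - apply is_derive_pseries; [exact PH0_pseries_h|exact Hz].
  - apply is_derive_pseries; [exact PH0_pseries_g|exact Hz].
Qed.

Definition twist_coef (eps : C) (k : nat) : C :=
  (dcoef a k + eps * dcoef b k - match k with O => RtoC alpha | _ => RtoC 0 end)%C.

Definition twist (eps z : C) : C := (dsum a z + eps * dsum b z - RtoC alpha)%C.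

Lemma PH0_twist_pseries (eps z : C) : Cmod z < 1 ->
  is_pseries (twist_coef eps) z (twist eps z).
Proof.
  intros Hz.
  generalize (proj1 (is_pseries_Cseries _ _ _) (is_pseries_dsum a h PH0_pseries_h z Hz)). intros H1.
  generalize (proj1 (is_pseries_Cseries _ _ _) (is_pseries_dsum b g PH0_pseries_g z Hz)). intros H2.
  generalize (proj1 (is_pseries_Cseries _ _ _) (is_pseries_const (RtoC alpha) z)). intros H3.
  apply is_pseries_Cseries.
  generalize (is_series_minus _ _ _ _
    (is_series_plus _ _ _ _ H1 (@is_series_scal_l C_AbsRing C_NormedModule eps _ _ H2)) H3).
  apply is_series_ext. intros k. unfold twist_coef.
  change ((z ^ k * dcoef a k + eps * (z ^ k * dcoef b k)
     - z ^ k * match k with O => RtoC alpha | _ => RtoC 0 end)%C =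
    (z ^ k * (dcoef a k + eps * dcoef b k - match k with O => RtoC alpha | _ => RtoC 0 end))%C).
  ring.
Qed.

Lemma PH0_twist_pos (eps z : C) : Cmod eps = 1 -> Cmod z < 1 -> 0 <= Re (twist eps z).
Proof.
  intros He Hz. generalize (PH0_dsum z Hz). intros H.
  assert (H1 : Rabs (Re (eps * dsum b z)) <= Cmod (dsum b z)).
  { eapply Rle_trans; [apply re_le_Cmod|]. rewrite Cmod_mult, He. lra. }
  apply Rabs_le_between in H1.
  unfold twist, Cminus. rewrite !re_plus. simpl (Re (- RtoC alpha)). lra.
Qed.

Lemma PH0_twist_coef0 (eps : C) : Re (twist_coef eps 0) = 1 - alpha.
Proof.
  destruct HPH as [[_ [Ha [_ [Hb _]]]] _].
  unfold twist_coef, dcoef. rewrite Ha, Hb. unfold Re; simpl. ring.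
Qed.

(** With [eps] = e^(i(s - t)) the number eps b_n has the argument of a_n. The coefficient of h' +
    eps g' at index n - 1 is n (a_n + eps b_n), whence the division by n. *)
Lemma PH0_coef (n : nat) : (2 <= n)%nat ->
  Cmod (a n) + Cmod (b n) <= 2 * (1 - alpha) / INR n.
Proof.
  intros Hn. destruct n as [|[|k]]; [lia|lia|].
  set (n := S (S k)) in *.
  destruct (Cpolar (a n)) as [s Hs]. destruct (Cpolar (b n)) as [t Ht].
  set (eps := Cexpi (s - t)).
  assert (He : Cmod eps = 1) by apply Cmod_Cexpi.
  generalize (caratheodory_coef (twist_coef eps) (twist eps) (PH0_twist_pseries eps)
    (fun z Hz => PH0_twist_pos eps z He Hz) (S k) ltac:(lia)).
  rewrite PH0_twist_coef0. unfold twist_coef, dcoef. fold n.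
  replace (RtoC (INR n) * a n + eps * (RtoC (INR n) * b n) - 0)%C
    with (RtoC (INR n) * (RtoC (Cmod (a n) + Cmod (b n)) * Cexpi s))%C.
  - assert (Hn0 : 0 < INR n) by (apply lt_0_INR; lia).
    rewrite !Cmod_mult, Cmod_Cexpi, !Cmod_R.
    generalize (Cmod_ge_0 (a n)), (Cmod_ge_0 (b n)). intros P1 P2.
    rewrite (Rabs_pos_eq (INR n)), Rabs_pos_eq by lra. intros H.
    apply Rmult_le_reg_l with (INR n); [exact Hn0|].
    replace (INR n * (2 * (1 - alpha) / INR n)) with (2 * (1 - alpha)) by (field; lra). lra.
  - assert (E : (eps * b n)%C = (RtoC (Cmod (b n)) * Cexpi s)%C).
    { rewrite Ht at 1. unfold eps.
      replace (Cexpi (s - t) * (RtoC (Cmod (b n)) * Cexpi t))%C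
        with (RtoC (Cmod (b n)) * (Cexpi (s - t) * Cexpi t))%C by ring.
      rewrite <- Cexpi_plus. do 2 f_equal. ring. }
    replace (RtoC (INR n) * a n + eps * (RtoC (INR n) * b n) - 0)%C
      with (RtoC (INR n) * (a n + eps * b n))%C by ring.
    rewrite E. rewrite Hs at 2. rewrite RtoC_plus. ring.
Qed.

(** The unimodular [eps] with eps g'(z) = -|g'(z)| depends on [z], which is harmless as Harnack's
    bound is the same for every [eps]. *)
Lemma PH0_dsum_ge (z : C) : Cmod z < 1 ->
  alpha + (1 - alpha) * ((1 - Cmod z) / (1 + Cmod z)) <= Re (dsum a z) - Cmod (dsum b z).
Proof.
  intros Hz. destruct (Cpolar (dsum b z)) as [s Hs].
  set (eps := Cexpi (PI - s)).
  assert (He : Cmod eps = 1) by apply Cmod_Cexpi.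
  generalize (caratheodory_harnack (twist_coef eps) (twist eps) (PH0_twist_pseries eps)
    (fun z Hz => PH0_twist_pos eps z He Hz) z Hz).
  rewrite PH0_twist_coef0. unfold twist.
  replace (eps * dsum b z)%C with (RtoC (- Cmod (dsum b z))).
  - unfold Cminus. rewrite !re_plus. simpl (Re (- RtoC alpha)). simpl (Re (RtoC _)). lra.
  - rewrite Hs at 2. unfold eps.
    replace (Cexpi (PI - s) * (RtoC (Cmod (dsum b z)) * Cexpi s))%C
        with (RtoC (Cmod (dsum b z)) * (Cexpi (PI - s) * Cexpi s))%C by ring.
    rewrite <- Cexpi_plus. replace (PI - s + s) with PI by ring.
    rewrite Cexpi_PI, <- RtoC_mult. f_equal. ring.
Qed.

Lemma PH0_lipschitz (rho : R) : 0 < rho < 1 ->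
  exists B, 0 <= B /\ forall z w, Cmod z <= rho -> Cmod w <= rho ->
    Cmod (f w - f z) <= B * Cmod (w - z).
Proof.
  intros Hr.
  destruct (pseries_lipschitz a h PH0_pseries_h rho Hr) as [B1 [HB1 H1]].
  destruct (pseries_lipschitz b g PH0_pseries_g rho Hr) as [B2 [HB2 H2]].
  exists (B1 + B2). split; [lra|]. intros z w Hz Hw.
  unfold f, harm.
  replace (h w + Cconj (g w) - (h z + Cconj (g z)))%C
    with ((h w - h z) + Cconj (g w - g z))%C by (rewrite Cminus_conj; ring).
  eapply Rle_trans; [apply Cmod_triangle|]. rewrite Cmod_conj.
  generalize (H1 z w Hz Hw), (H2 z w Hz Hw). lra.
Qed.

(** The real differential of [f] at [z] in the direction [u]. *)
Definition dirder (z u : C) : C := (dsum a z * u + Cconj (dsum b z * u))%C.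

(** The analytic part contributes exactly Re h' |u|^2; the conjugated one has modulus |g'| |u| and
    can take away at most |g'| |u|^2. *)
Lemma PH0_dirder_ge (z u : C) :
  (Re (dsum a z) - Cmod (dsum b z)) * Cmod u ^ 2 <= Cdot u (dirder z u).
Proof.
  unfold dirder. rewrite Cdot_plus_r.
  assert (E : Cdot u (dsum a z * u) = Re (dsum a z) * Cmod u ^ 2).
  { rewrite Cmod2_alt. unfold Cdot, Re, Im; simpl. ring. }
  generalize (Cdot_le u (Cconj (dsum b z * u))). rewrite Cmod_conj, Cmod_mult. intros H.
  apply Rabs_le_between in H. rewrite E. nra.
Qed.

Lemma PH0_segment_derivable (z u : C) (t : R) : Cmod (z + RtoC t * u) < 1 ->
  derivable_pt_lim (fun t => Cdot u (f (z + RtoC t * u))) t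
    (Cdot u (dirder (z + RtoC t * u) u)).
Proof.
  intros Hp. set (p := (z + RtoC t * u)%C) in *.
  set (rho := (1 + Cmod p) / 2).
  assert (Hpr : Cmod p < rho < 1) by (unfold rho; lra).
  assert (Hr : 0 < rho < 1) by (generalize (Cmod_ge_0 p); lra).
  destruct (pseries_taylor a h PH0_pseries_h rho Hr) as [B1 [HB1 H1]].
  destruct (pseries_taylor b g PH0_pseries_g rho Hr) as [B2 [HB2 H2]].
  generalize (Cmod_ge_0 u); intros Hu.
  apply (derivable_pt_lim_quadratic _ t _ (Cmod u * ((B1 + B2) * Cmod u ^ 2))
    (* This keeps [p + s u] in the disc of radius [rho]; adding 1 covers u = 0. *)
    ((rho - Cmod p) / (Cmod u + 1))).
  - apply Rdiv_lt_0_compat; lra.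
  - apply Rmult_le_pos; [exact Hu|]. apply Rmult_le_pos; [lra|apply pow2_ge_0].
  - intros s Hs.
    replace (z + RtoC (t + s) * u)%C with (p + RtoC s * u)%C
      by (unfold p; rewrite RtoC_plus; ring).
    fold p. set (q := (p + RtoC s * u)%C).
    assert (Eq : (q - p)%C = (RtoC s * u)%C) by (unfold q; ring).
    assert (Eqm : Cmod (q - p) = Rabs s * Cmod u) by (rewrite Eq, Cmod_mult, Cmod_R; reflexivity).
    assert (Hq : Cmod q <= rho).
    { unfold q. eapply Rle_trans; [apply Cmod_triangle|]. rewrite Cmod_mult, Cmod_R.
      apply Rmult_lt_compat_r with (r := Cmod u + 1) in Hs; [|lra].
      unfold Rdiv in Hs. rewrite Rmult_assoc, Rinv_l in Hs by lra.
      generalize (Rabs_pos s). nra. }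
    specialize (H1 p q ltac:(lra) Hq). specialize (H2 p q ltac:(lra) Hq).
    rewrite <- Cdot_minus_r, (Rmult_comm _ s), <- Cdot_scal_r, <- Cdot_minus_r.
    eapply Rle_trans; [apply Cdot_le|]. rewrite Rmult_assoc.
    apply Rmult_le_compat_l; [exact Hu|].
    replace (f q - f p - RtoC s * dirder p u)%C with
      ((h q - h p - dsum a p * (q - p)) + Cconj (g q - g p - dsum b p * (q - p)))%C.
    + eapply Rle_trans; [apply Cmod_triangle|]. rewrite Cmod_conj.
      rewrite Eqm in H1, H2. rewrite Rpow_mult_distr, pow2_abs in H1, H2. nra.
    + rewrite Eq. unfold f, harm, dirder.
      rewrite !Cminus_conj, !Cmult_conj.
      replace (Cconj (RtoC s)) with (RtoC s) by (unfold Cconj, RtoC; simpl; f_equal; ring).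
      ring.
Qed.

(** The Harnack bound at modulus [rho]; as it decreases, it is the monotonicity constant of [f] on
    the whole disc of that radius. *)
Definition modulus (rho : R) : R := alpha + (1 - alpha) * ((1 - rho) / (1 + rho)).

Lemma modulus_pos (rho : R) : 0 <= rho < 1 -> 0 < modulus rho.
Proof.
  intros Hr. unfold modulus.
  assert (0 < (1 - rho) / (1 + rho)) by (apply Rdiv_lt_0_compat; lra). nra.
Qed.

Lemma modulus_decr (s rho : R) : 0 <= s <= rho -> modulus rho <= modulus s.
Proof.
  intros Hr. unfold modulus. apply Rplus_le_compat_l, Rmult_le_compat_l; [lra|].
  apply Rmult_le_reg_r with ((1 + rho) * (1 + s)); [nra|].
  replace ((1 - rho) / (1 + rho) * ((1 + rho) * (1 + s))) with ((1 - rho) * (1 + s)) by (field; lra).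
  replace ((1 - s) / (1 + s) * ((1 + rho) * (1 + s))) with ((1 - s) * (1 + rho)) by (field; lra).
  nra.
Qed.

(** The disc is convex, so the mean value theorem applies along the segment to the scalar function
    <u, f(z + t u)>, whose derivative is bounded below by [PH0_dirder_ge]. *)
Lemma PH0_monotone (rho : R) : 0 <= rho < 1 -> forall z w, Cmod z <= rho -> Cmod w <= rho ->
  modulus rho * Cmod (w - z) ^ 2 <= Cdot (w - z) (f w - f z).
Proof.
  intros Hr z w Hz Hw. set (u := (w - z)%C).
  assert (Hseg : forall t, 0 <= t <= 1 -> Cmod (z + RtoC t * u) <= rho).
  { intros t Ht. replace (z + RtoC t * u)%C with (RtoC (1 - t) * z + RtoC t * w)%C
      by (unfold u; rewrite RtoC_minus; ring).
    eapply Rle_trans; [apply Cmod_triangle|].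
    rewrite !Cmod_mult, !Cmod_R, !Rabs_pos_eq by lra. nra. }
  destruct (MVT_cor2 (fun t => Cdot u (f (z + RtoC t * u)))
    (fun t => Cdot u (dirder (z + RtoC t * u) u)) 0 1 Rlt_0_1) as [t [Ht Ht']].
  { intros t Ht. apply PH0_segment_derivable. specialize (Hseg t Ht). lra. }
  replace (z + RtoC 1 * u)%C with w in Ht by (unfold u; ring).
  replace (z + RtoC 0 * u)%C with z in Ht by ring.
  rewrite Cdot_minus_r, Ht. specialize (Hseg t ltac:(lra)). set (p := (z + RtoC t * u)%C) in *.
  rewrite Rminus_0_r, Rmult_1_r. eapply Rle_trans; [|apply PH0_dirder_ge].
  apply Rmult_le_compat_r; [apply pow2_ge_0|].
  eapply Rle_trans; [|apply PH0_dsum_ge; lra].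
  apply modulus_decr. split; [apply Cmod_ge_0|exact Hseg].
Qed.

Lemma PH0_0 : f (RtoC 0) = RtoC 0.
Proof.
  assert (E : forall (c : nat -> C) (k : C -> C), c 0%nat = RtoC 0 ->
    (forall z, Cmod z < 1 -> is_pseries c z (k z)) -> k (RtoC 0) = RtoC 0).
  { intros c k Hc Hk.
    assert (H0 : Cmod (RtoC 0) < 1) by (rewrite Cmod_0; lra).
    apply Cmod_eq_0, Rle_antisym; [|apply Cmod_ge_0].
    apply (Cmod_is_series_le (fun n => (RtoC 0 ^ n * c n)%C) (fun n => 0 * 0 ^ n)).
    - apply is_pseries_Cseries. now apply Hk.
    - assert (Hs := is_series_geom_scal 0 0 ltac:(lra)).
      now replace (0 * / (1 - 0)) with 0 in Hs by ring.
    - intros [|n]; [rewrite Hc|simpl Cpow]; rewrite !Cmod_mult, Cmod_0; lra. }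
  destruct HPH as [[Ha [_ [Hb [_ _]]]] _].
  unfold f, harm. rewrite (E a h Ha PH0_pseries_h), (E b g Hb PH0_pseries_g).
  unfold Cconj, Cplus, RtoC; simpl. f_equal; ring.
Qed.

(** The mean value theorem is applied to <u, f(t u)> + extremal(-t), which vanishes at 0 and has a
    nonnegative derivative, since that of extremal(-t) is -[modulus t]. *)
Lemma PH0_growth (z : C) : Cmod z < 1 ->
  Cmod z * - extremal alpha (- Cmod z) <= Cdot z (f z).
Proof.
  intros Hz. destruct (Cpolar z) as [s Hs]. set (r := Cmod z) in *. set (u := Cexpi s) in *.
  assert (Hr : 0 <= r) by apply Cmod_ge_0.
  assert (Hu : Cmod u = 1) by apply Cmod_Cexpi.
  rewrite Hs, Cdot_scal_l. apply Rmult_le_compat_l; [exact Hr|].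
  destruct (Req_dec r 0) as [E|E].
  { rewrite E, Ropp_0, extremal_0. replace (RtoC 0 * u)%C with (RtoC 0) by ring.
    rewrite PH0_0. unfold Cdot, Re, Im; simpl. lra. }
  assert (Hray : forall t, 0 <= t <= r -> Cmod (RtoC 0 + RtoC t * u) = t).
  { intros t Ht. rewrite Cplus_0_l, Cmod_mult, Hu, Cmod_R, Rabs_pos_eq; lra. }
  destruct (MVT_cor2 (fun t => Cdot u (f (RtoC 0 + RtoC t * u)) + extremal alpha (- t))
    (fun t => Cdot u (dirder (RtoC 0 + RtoC t * u) u) + - modulus t) 0 r ltac:(lra))
    as [t [Ht Ht']].
  { intros t Ht.
    apply (derivable_pt_lim_plus (fun t => Cdot u (f (RtoC 0 + RtoC t * u)))).
    - apply PH0_segment_derivable. rewrite Hray; lra.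
    - replace (- modulus t) with ((alpha + (1 - alpha) * ((1 + - t) / (1 - - t))) * -1)
        by (unfold modulus, Rminus; rewrite Ropp_involutive; ring).
      apply (derivable_pt_lim_comp (fun t => - t) (extremal alpha)).
      + apply is_derive_Reals. auto_derive; [exact I|ring].
      + apply extremal_derivable. lra. }
  rewrite Ropp_0, extremal_0 in Ht.
  replace (RtoC 0 + RtoC 0 * u)%C with (RtoC 0) in Ht by ring. rewrite PH0_0 in Ht.
  replace (Cdot u (RtoC 0)) with 0 in Ht by (unfold Cdot, Re, Im; simpl; ring).
  rewrite Cplus_0_l in Ht.
  specialize (Hray t ltac:(lra)). set (p := (RtoC 0 + RtoC t * u)%C) in *.
  assert (H1 := PH0_dirder_ge p u). rewrite Hu in H1.
  assert (H2 := PH0_dsum_ge p ltac:(lra)). rewrite Hray in H2. fold (modulus t) in H2.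
  nra.
Qed.

Lemma PH0_covers (w : C) : Cmod w < - extremal alpha (-1) -> image_disk f w.
Proof.
  intros Hw.
  destruct (left_limit_gt (fun r => - extremal alpha (- r)) 0 (Cmod w)) as [rho' [Hr' Hw']].
  - lra.
  - apply continuity_pt_opp.
    apply (continuity_pt_comp (fun r => - r) (extremal alpha)).
    + apply continuity_pt_opp, derivable_continuous_pt, derivable_pt_id.
    + apply extremal_continuous. lra.
  - exact Hw.
  - set (rho := (1 + rho') / 2).
    assert (Hr : rho' < rho < 1) by (unfold rho; lra).
    destruct (PH0_lipschitz rho ltac:(lra)) as [B [HB Hlip]].
    destruct (monotone_covers f rho' rho (modulus rho) B
      (* By the growth estimate <z, f z - w> is at least |z| (-extremal(-|z|) - |w|); both factors
         increase with |z|, so the value at rho' works as [kap] on the annulus. *)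
      (rho' * (- extremal alpha (- rho') - Cmod w)) w) as [z [Hz Hfz]]; auto.
    + lra.
    + apply modulus_pos. lra.
    + apply Rmult_lt_0_compat; lra.
    + apply PH0_monotone. lra.
    + intros z Hz. rewrite Cdot_minus_r.
      assert (H1 := PH0_growth z ltac:(lra)).
      assert (H2 := Cdot_le z w). apply Rabs_le_between in H2.
      assert (H3 : extremal alpha (- Cmod z) <= extremal alpha (- rho')).
      { destruct (Req_dec (Cmod z) rho') as [->|Hne]; [lra|].
        apply Rlt_le, extremal_increasing; lra. }
      assert (rho' * (- extremal alpha (- rho') - Cmod w)
         <= Cmod z * (- extremal alpha (- Cmod z) - Cmod w)).
      { apply Rmult_le_compat; lra. }
      lra.
    + exists z. split; [lra|now rewrite Hfz].
Qed.

(** A boundary point inside the covered disc would be interior to the image. *)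
Lemma PH0_dist_ge : Rbar_le (- extremal alpha (-1)) (dist_bdry f).
Proof.
  unfold dist_bdry.
  apply (proj2 (Glb_Rbar_correct _)). intros x [w [[_ Hw] ->]]. rewrite PH0_0.
  replace (w - RtoC 0)%C with w by ring. simpl. apply Rnot_lt_le. intros Hlt. apply Hw.
  exists (- extremal alpha (-1) - Cmod w). split; [lra|].
  intros s Hs. apply PH0_covers.
  generalize (Cmod_le_sub s w). lra.
Qed.

Lemma PH0_bohr_sum_le (r : R) : 0 <= r < 1 -> bohr_sum a b r <= extremal alpha r.
Proof.
  intros Hr. unfold bohr_sum, extremal. apply Rplus_le_compat_l.
  rewrite <- (is_series_unique _ _ (is_series_log_tail r ltac:(lra))), <- Series_scal_l.
  apply Series_le.
  - intros n. assert (Hp : 0 <= r ^ (n + 2)) by (apply pow_le; lra).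
    generalize (Cmod_ge_0 (a (n + 2)%nat)), (Cmod_ge_0 (b (n + 2)%nat)). intros P1 P2.
    split; [apply Rmult_le_pos; lra|].
    replace (2 * (1 - alpha) * (r ^ (n + 2) / INR (n + 2))) with
      (2 * (1 - alpha) / INR (n + 2) * r ^ (n + 2)) by (unfold Rdiv; ring).
    apply Rmult_le_compat_r; [exact Hp|]. apply PH0_coef. lia.
  - eexists. apply is_series_Rscal, is_series_log_tail. lra.
Qed.

End ClassPH0.

(** * The extremal function *)

Section Extremal.

Variables (alpha : R) (ha : C -> C).
Hypothesis Halpha : 0 <= alpha < 1.
Hypothesis Hha : forall z, Cmod z < 1 -> is_pseries (coef_alpha alpha) z (ha z).

Lemma dcoef_alpha (k : nat) : dcoef (coef_alpha alpha) (S k) = RtoC (2 * (1 - alpha)).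
Proof.
  unfold dcoef, coef_alpha. rewrite <- RtoC_mult. f_equal. field. apply not_0_INR; lia.
Qed.

(* The coefficients [1, c, c, ...] (with [c = 2(1 - alpha)]) are, after a shift,
   themselves up to the constant term. *)
Lemma dsum_alpha_eq (z : C) : Cmod z < 1 ->
  (dsum (coef_alpha alpha) z * (1 - z))%C = (1 + RtoC (1 - 2 * alpha) * z)%C.
Proof.
  intros Hz. set (c := dcoef (coef_alpha alpha)). set (S := dsum (coef_alpha alpha) z).
  assert (H1 : is_series (fun k => (z ^ k * c k)%C) S)
    by (apply is_pseries_Cseries, (is_pseries_dsum _ ha Hha z Hz)).
  assert (Hc0 : c 0%nat = RtoC 1).
  { unfold c, dcoef, coef_alpha. simpl. ring. }
  assert (H2 : is_series (fun k => (z ^ k * c (Datatypes.S k))%C) (S + RtoC (1 - 2 * alpha))%C).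
  { generalize (is_series_plus _ _ _ _ H1
      (proj1 (is_pseries_Cseries _ _ _) (is_pseries_const (RtoC (1 - 2 * alpha)) z))).
    apply is_series_ext. intros [|k].
    - unfold c at 2. rewrite dcoef_alpha, Hc0.
      change ((z ^ 0 * 1 + z ^ 0 * RtoC (1 - 2 * alpha))%C = (z ^ 0 * RtoC (2 * (1 - alpha)))%C).
      replace (2 * (1 - alpha)) with (1 + (1 - 2 * alpha)) by ring. rewrite RtoC_plus. simpl. ring.
    - unfold c. rewrite !dcoef_alpha.
      change ((z ^ Datatypes.S k * RtoC (2 * (1 - alpha)) + z ^ Datatypes.S k * 0)%C =
        (z ^ Datatypes.S k * RtoC (2 * (1 - alpha)))%C). ring. }
  assert (H3 : is_series (fun k => (z ^ k * c k)%C) (z * (S + RtoC (1 - 2 * alpha)) + 1)%C).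
  { apply is_series_decr_1.
    match goal with |- is_series _ ?l => replace l with (z * (S + RtoC (1 - 2 * alpha)))%C end.
    - generalize (@is_series_scal_l C_AbsRing C_NormedModule z _ _ H2).
      apply is_series_ext. intros k.
      change ((z * (z ^ k * c (Datatypes.S k)))%C = (z ^ Datatypes.S k * c (Datatypes.S k))%C).
      simpl. ring.
    - rewrite Hc0.
      change ((z * (S + RtoC (1 - 2 * alpha)))%C =
        (z * (S + RtoC (1 - 2 * alpha)) + 1 + - (z ^ 0 * 1))%C). simpl. ring. }
  assert (E : S = (z * (S + RtoC (1 - 2 * alpha)) + 1)%C).
  { exact (filterlim_locally_unique _ _ _ H1 H3). }
  transitivity (S - z * S)%C; [ring|]. rewrite E at 1. ring.
Qed.

Lemma dsum_alpha_pos (z : C) : Cmod z < 1 -> alpha < Re (dsum (coef_alpha alpha) z).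
Proof.
  intros Hz. generalize (dsum_alpha_eq z Hz). intros E.
  assert (Hm : Re z ^ 2 + Im z ^ 2 < 1).
  { rewrite <- Cmod2_alt. generalize (Cmod_ge_0 z). nra. }
  destruct (dsum (coef_alpha alpha) z) as [p q]. destruct z as [x y].
  unfold Re, Im in *. simpl fst in *. simpl snd in *.
  assert (E1 := f_equal fst E). assert (E2 := f_equal snd E). simpl in E1, E2.
  (* This is (Re h' - alpha) |1 - z|^2 = (1 - alpha)(1 - |z|^2), read off from both components of
     [dsum_alpha_eq] without dividing by 1 - z. *)
  assert (H : (p - alpha) * ((1 - x) ^ 2 + y ^ 2) = (1 - alpha) * (1 - (x ^ 2 + y ^ 2))).
  { assert (F1 : p * (1 - x) + q * y = 1 + (1 - 2 * alpha) * x) by lra.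
    assert (F2 : q * (1 - x) - p * y = (1 - 2 * alpha) * y) by lra.
    replace ((p - alpha) * ((1 - x) ^ 2 + y ^ 2)) with
      ((p * (1 - x) + q * y) * (1 - x) - (q * (1 - x) - p * y) * y
       - alpha * ((1 - x) ^ 2 + y ^ 2)) by ring.
    rewrite F1, F2. ring. }
  assert (0 < (1 - alpha) * (1 - (x ^ 2 + y ^ 2))) by (apply Rmult_lt_0_compat; lra).
  assert (0 <= (1 - x) ^ 2 + y ^ 2) by (generalize (pow2_ge_0 (1 - x)), (pow2_ge_0 y); lra).
  nra.
Qed.

Lemma extremal_in_PH0 :
  in_PH0 alpha ha (fun _ => RtoC 0) (coef_alpha alpha) zero_coef.
Proof.
  split.
  - do 4 (split; [reflexivity|]). intros z Hz. split; [now apply Hha|].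
    apply is_pseries_Cseries.
    generalize (proj1 (is_pseries_Cseries _ _ _) (is_pseries_const (RtoC 0) z)).
    apply is_series_ext. now intros [|n].
  - intros z Hz h' g' Hh' Hg'.
    rewrite (is_derive_C_unique _ _ _ _ Hh' (is_derive_pseries _ _ Hha z Hz)).
    assert (Hg0 : is_derive (fun _ : C => RtoC 0) z (RtoC 0))
      by apply (@is_derive_const C_AbsRing C_NormedModule).
    rewrite (is_derive_C_unique _ _ _ _ Hg' Hg0), Cmod_0.
    generalize (dsum_alpha_pos z Hz). lra.
Qed.

Lemma extremal_real (x : R) : -1 < x < 1 -> ha (RtoC x) = RtoC (extremal alpha x).
Proof.
  intros Hx.
  assert (Hz : Cmod (RtoC x) < 1) by (rewrite Cmod_R; apply Rabs_def1; lra).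
  generalize (proj1 (is_pseries_Cseries _ _ _) (Hha _ Hz)). intros H.
  assert (Hre : is_series (fun k => x ^ k * Re (coef_alpha alpha k)) (extremal alpha x)).
  { apply is_series_decr_1, is_series_decr_1.
    match goal with |- is_series _ ?l =>
      replace l with (2 * (1 - alpha) * (- ln (1 - x) - x)) end.
    - generalize (is_series_Rscal (2 * (1 - alpha)) _ _ (is_series_log_tail x ltac:(lra))).
      apply is_series_Rext. intros n. replace (n + 2)%nat with (S (S n)) by lia.
      unfold coef_alpha, Re, RtoC. cbn [fst]. unfold Rdiv. ring.
    - change (2 * (1 - alpha) * (- ln (1 - x) - x) =
        extremal alpha x + - (x ^ 0 * 0) + - (x ^ 1 * 1)). unfold extremal. simpl. ring. }
  assert (H' : is_series (fun k => (RtoC x ^ k * coef_alpha alpha k)%C) (RtoC (extremal alpha x))).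
  { apply is_series_C.
    assert (Hk : forall k, (RtoC x ^ k * coef_alpha alpha k)%C =
      RtoC (x ^ k * Re (coef_alpha alpha k))).
    { intros k. rewrite RtoC_mult, RtoC_pow. f_equal.
      destruct k as [|[|k]]; reflexivity. }
    split.
    - revert Hre. apply is_series_Rext. intros k. now rewrite Hk.
    - simpl (Im (RtoC _)). apply is_series_Rext with (fun k => 0 * 0 ^ k).
      + intros k. rewrite Hk. simpl. ring.
      + assert (Hs := is_series_geom_scal 0 0 ltac:(lra)).
        now replace (0 * / (1 - 0)) with 0 in Hs by ring. }
  exact (filterlim_locally_unique _ _ _ H H').
Qed.

Let fa : C -> C := harm ha (fun _ => RtoC 0).

Lemma fa_ha (z : C) : fa z = ha z.
Proof. unfold fa, harm. destruct (ha z). unfold Cplus, Cconj, RtoC; simpl. f_equal; ring. Qed.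

(* By monotonicity along vertical segments, [fa] takes real values only on the real
   axis, where it is increasing with infimum [extremal alpha (-1)]. *)
Lemma extremal_not_image : ~ image_disk fa (RtoC (extremal alpha (-1))).
Proof.
  intros [z [Hz E]].
  assert (Hx : Rabs (Re z) <= Cmod z) by apply re_le_Cmod.
  assert (Hx1 : -1 < Re z < 1) by (apply Rabs_le_between in Hx; lra).
  assert (Hy : Im z = 0).
  { assert (H := PH0_monotone _ _ _ _ _ Halpha extremal_in_PH0 (Cmod z)
      (conj (Cmod_ge_0 z) Hz) (RtoC (Re z)) z ltac:(rewrite Cmod_R; exact Hx) (Rle_refl _)).
    fold fa in H. rewrite <- E, fa_ha, extremal_real in H by exact Hx1.
    assert (Hm := modulus_pos alpha Halpha (Cmod z) (conj (Cmod_ge_0 z) Hz)).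
    set (m := modulus _ _) in *.
    (* The increment from [Re z] to [z] is vertical and the increment of the values is real, so they
       are orthogonal. *)
    replace (Cdot _ _) with 0 in H.
    - assert (H0 : m * Im z ^ 2 <= 0).
      { eapply Rle_trans; [|exact H]. right. rewrite Cmod2_alt. unfold Re, Im; simpl. ring. }
      generalize (pow2_ge_0 (Im z)); intros H2.
      assert (H3 : Im z ^ 2 = 0) by nra.
      now apply Rsqr_0_uniq; rewrite Rsqr_pow2.
    - unfold Cdot, Re, Im; simpl. ring. }
  assert (Ez : z = RtoC (Re z)) by (destruct z; unfold RtoC, Re, Im in *; simpl in *; now rewrite Hy).
  rewrite fa_ha, Ez, extremal_real in E by exact Hx1.
  apply (f_equal Re) in E. simpl in E.
  generalize (extremal_increasing alpha (-1) (Re z) Halpha). lra.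
Qed.

Lemma extremal_boundary : boundary (image_disk fa) (RtoC (extremal alpha (-1))).
Proof.
  split.
  - intros eps Heps.
    destruct (extremal_continuous alpha (-1) ltac:(lra) eps Heps) as [d [Hd H]].
    set (x := -1 + Rmin d 1 / 2).
    assert (Hm : 0 < Rmin d 1) by (apply Rmin_glb_lt; lra).
    generalize (Rmin_l d 1), (Rmin_r d 1). intros M1 M2.
    assert (Hx : -1 < x < 1) by (unfold x; lra).
    exists (RtoC (extremal alpha x)). split.
    + exists (RtoC x). split; [rewrite Cmod_R; apply Rabs_def1; lra|].
      now rewrite fa_ha, extremal_real.
    + rewrite <- RtoC_minus, Cmod_R. apply H. split; [split; [exact I|lra]|].
      simpl. unfold R_dist, x. rewrite Rabs_pos_eq; lra.
  - intros [eps [Heps H]]. apply extremal_not_image, H.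
    replace (RtoC (extremal alpha (-1)) - RtoC (extremal alpha (-1)))%C with (RtoC 0) by ring.
    now rewrite Cmod_0.
Qed.

Lemma extremal_dist : dist_bdry fa = Finite (- extremal alpha (-1)).
Proof.
  apply Rbar_le_antisym; [|exact (PH0_dist_ge _ _ _ _ _ Halpha extremal_in_PH0)].
  unfold dist_bdry. apply (proj1 (Glb_Rbar_correct _)).
  exists (RtoC (extremal alpha (-1))). split; [exact extremal_boundary|].
  unfold fa. rewrite (PH0_0 _ _ _ _ _ extremal_in_PH0).
  rewrite <- RtoC_minus, Cmod_R, Rminus_0_r, Rabs_left; [reflexivity|].
  rewrite <- (extremal_0 alpha). apply extremal_increasing; lra.
Qed.

Lemma extremal_bohr_sum (r : R) : 0 <= r < 1 ->
  bohr_sum (coef_alpha alpha) zero_coef r = extremal alpha r.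
Proof.
  intros Hr. unfold bohr_sum, extremal. f_equal.
  rewrite <- (is_series_unique _ _ (is_series_log_tail r ltac:(lra))), <- Series_scal_l.
  apply Series_ext. intros n. replace (n + 2)%nat with (S (S n)) by lia.
  unfold coef_alpha, zero_coef.
  assert (Hn : 0 < INR (S (S n))) by (apply lt_0_INR; lia).
  rewrite Cmod_0, Cmod_R, Rabs_pos_eq; [unfold Rdiv; ring|].
  apply Rle_mult_inv_pos; lra.
Qed.

End Extremal.

Theorem theorem2p2 (alpha : R) (Halpha : 0 <= alpha < 1) :
  (exists! r : R, 0 < r < 1 /\ rf_eq alpha r) /\
  (forall r : R, 0 < r < 1 -> rf_eq alpha r ->
     (forall (h g : C -> C) (a b : nat -> C),
        in_PH0 alpha h g a b ->
        forall z : C, Cmod z <= r ->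
          Rbar_le (Finite (bohr_sum a b (Cmod z))) (dist_bdry (harm h g))) /\
     (forall h_alpha : C -> C,
        (forall z : C, Cmod z < 1 -> is_pseries (coef_alpha alpha) z (h_alpha z)) ->
        in_PH0 alpha h_alpha (fun _ => RtoC 0) (coef_alpha alpha) zero_coef /\
        (forall z : C, Cmod z = r ->
           dist_bdry (harm h_alpha (fun _ => RtoC 0)) =
           Finite (bohr_sum (coef_alpha alpha) zero_coef (Cmod z))) /\
        (forall z : C, r < Cmod z < 1 ->
           Rbar_lt (dist_bdry (harm h_alpha (fun _ => RtoC 0)))
                   (Finite (bohr_sum (coef_alpha alpha) zero_coef (Cmod z)))))).
Proof.
  split; [now apply rf_exists_unique|].
  intros r Hr Hrf. apply rf_eq_extremal in Hrf; [|lra]. split.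
  - intros h g a b H z Hz.
    (* The chain is Bohr sum <= extremal(|z|) <= extremal(r) = -extremal(-1) <= distance. *)
    apply Rbar_le_trans with (Finite (- extremal alpha (-1)));
      [|now apply PH0_dist_ge with a b].
    generalize (Cmod_ge_0 z); intros Hz0.
    simpl. rewrite <- Hrf. apply Rle_trans with (extremal alpha (Cmod z)).
    + apply PH0_bohr_sum_le with h g; auto. lra.
    + destruct (Req_dec (Cmod z) r) as [->|Hne]; [lra|].
      apply Rlt_le, extremal_increasing; lra.
  - intros ha Hha. split; [|split].
    + now apply extremal_in_PH0.
    + intros z Hz. rewrite (extremal_dist alpha ha Halpha Hha), Hz, <- Hrf.
      now rewrite extremal_bohr_sum by lra.
    + intros z Hz. rewrite (extremal_dist alpha ha Halpha Hha), <- Hrf.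
      rewrite extremal_bohr_sum by lra. simpl. apply extremal_increasing; lra.
Qed.
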